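(* There exists a constant $C>0$ such that for all integers $n\ge2$ and $\ell$ with $1\le\ell<n$, there exists an $\ell$-covering set of $\mathbb{Z}_n$ of size at most $C\,\frac{n\log n}{\ell}$; that is, $f(n,\ell)\le C\,\frac{n\log n}{\ell}$.
   Context: For integers $n\ge 2$ and $\ell\ge0$, a set $B\subseteq\mathbb{Z}_n$ is an $\ell$-covering set if $\{ab\bmod n: 0\le a\le\ell,\ b\in B\}=\mathbb{Z}_n$, and $f(n,\ell)$ is the minimum size of an $\ell$-covering set of $\mathbb{Z}_n$. Convention: $\log x$ denotes $\max(\ln x,1)$. *)

(* Defs.v *)
From mathcomp Require Import all_boot.
From Stdlib Require Import Reals.

Set Implicit Arguments.
Unset Strict Implicit.
Unset Printing Implicit Defensive.

Definition covering_set (n l : nat) (B : {set 'I_n}) : Prop :=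
  forall x : 'I_n, exists a : nat, exists2 b : 'I_n,
    (a <= l)%N & (b \in B) /\ (a * b) %% n = x.

(* Paper convention: log x := max(ln x, 1). *)
Definition logm (x : R) : R := Rmax (ln x) 1.

(* Main.v *)
(** For [d] dividing [n] let [K_d] be the set of residues [x] with [gcd(x, n) = d]. The units of
    [Z_n] act transitively on each [K_d], so every [x] in [K_(ef)] is a multiple [a b] with
    [a <= l] for the same number of [b] in [K_e], and double counting bounds that number below
    in terms of the number [D] of [a'] up to [l / f] coprime to [m = n / (ef)]. The greedy
    algorithm then covers [K_(ef)] by at most [|K_(ef)| / D] times a logarithm many [b].

    Lower bounds for [D] come from Chebyshev's [pi(z) >> z / log z] alone: the products [j q] with
    [j <= M] coprime to [m] and [q > M] a prime not dividing [m] are distinct and coprime to [m],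
    and [sum_(j <= M, (j, m) = 1) 1 / j >= (phi(m) / m) sum_(j <= M) 1 / j], so that
    [D >> y phi(m) / m] for numbers up to [y], as soon as [y >= omega(m)^2].

    With [L = log n], three ranges of [l] are treated differently.
    - [l << L]: take [B = Z_n].
    - [log l << sqrt L]: cover each [K_d] by itself. The greedy factor is only [log l], which
      makes up for using just [D >> l / log l], and [sum_d |K_d| = n].
    - [log l >> sqrt L]: greedily chosen units cover all [K_d] with [l / d >> log(n / d)^2] at once. The
      other divisors [d] are large, and Rankin's trick, with
      [sum_(d | n) d^(-1/2) <= exp(O(sqrt L))], bounds both their number and the sum of their
      reciprocals; these classes are again covered one by one. *)

From Stdlib Require Import Reals.
Require Import Defs.
From mathcomp Require Import all_boot all_order all_algebra zify ring lra.
From mathcomp Require Import Rstruct.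
From Stdlib Require Lra.

Set Implicit Arguments.
Unset Strict Implicit.
Unset Printing Implicit Defensive.

Import Order.TTheory GRing.Theory Num.Theory.

(** * Chebyshev's lower bound for the number of primes *)

Definition primes_upto (z : nat) : seq nat := [seq p <- iota 1 z | prime p].

Lemma mem_primes_upto z p : (p \in primes_upto z) = (prime p && (p <= z)).
Proof.
rewrite mem_filter mem_iota add1n ltnS.
by case pp: (prime p) => //=; rewrite prime_gt0.
Qed.

Lemma uniq_primes_upto z : uniq (primes_upto z).
Proof. exact/filter_uniq/iota_uniq. Qed.

Lemma prod_primes_logn n : 0 < n -> n = \prod_(p <- primes n) p ^ logn p n.
Proof.
move=> n_gt0; rewrite {1}(prod_prime_decomp n_gt0) prime_decompE.
by rewrite big_map.
Qed.

Lemma leq_prod_expn (s : seq nat) (F : nat -> nat) b :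
  (forall i, i \in s -> F i <= b) -> \prod_(i <- s) F i <= b ^ size s.
Proof.
elim: s => [|i s IHs] Fb; first by rewrite big_nil.
rewrite big_cons expnS leq_mul ?Fb ?mem_head //.
by apply: IHs => j sj; apply: Fb; rewrite inE sj orbT.
Qed.

Lemma expn_leq_prod (s : seq nat) (F : nat -> nat) b :
  (forall i, i \in s -> b <= F i) -> b ^ size s <= \prod_(i <- s) F i.
Proof.
elim: s => [|i s IHs] Fb; first by rewrite big_nil.
rewrite big_cons expnS leq_mul ?Fb ?mem_head //.
by apply: IHs => j sj; apply: Fb; rewrite inE sj orbT.
Qed.

(** By Legendre's formula the exponent of [p] is the sum over [j] of [2k %/ p^j - 2 (k %/ p^j)].
    Each term is at most 1, and it vanishes once [p^j > 2k]. *)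
Lemma pfactor_central_bin k p : prime p -> 0 < k ->
  p ^ logn p 'C(k.*2, k) <= k.*2.
Proof.
move=> pr_p k_gt0; have p_gt1 := prime_gt1 pr_p.
have k2_gt0 : 0 < k.*2 by rewrite double_gt0.
suff le_tl : logn p 'C(k.*2, k) <= trunc_log p k.*2.
  by apply: leq_trans (trunc_logP p_gt1 k2_gt0); rewrite leq_pexp2l // prime_gt0.
have kk : k <= k.*2 by lia.
have := congr1 (logn p) (bin_fact kk).
have -> : k.*2 - k = k by lia.
rewrite !lognM ?fact_gt0 ?bin_gt0 ?muln_gt0 ?fact_gt0 //.
rewrite !logn_fact // => eq_log.
(* The added terms vanish since [k < p ^ j] for [j > k]; both Legendre sums then have the same
   range. *)
have widen : \sum_(1 <= j < k.+1) k %/ p ^ j = \sum_(1 <= j < (k.*2).+1) k %/ p ^ j.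
  rewrite [RHS](@big_cat_nat _ _ _ k.+1) //=.
  rewrite [X in _ = _ + X]big1_seq ?addn0 // => j /=.
  rewrite mem_index_iota => /andP[kj _]; apply: divn_small.
  by apply: leq_trans kj _; apply: ltnW; apply: ltn_expl.
move: eq_log; rewrite widen => eq_log.
have le_sum : \sum_(1 <= j < (k.*2).+1) k.*2 %/ p ^ j <=
  \sum_(1 <= j < (k.*2).+1) ((j <= trunc_log p k.*2) + k %/ p ^ j + k %/ p ^ j).
  apply: leq_sum => j _; set q := p ^ j.
  have q_gt0 : 0 < q by rewrite expn_gt0 prime_gt0.
  case: (leqP j _) => [_|lt_j].
    rewrite -ltnS ltn_divLR //; have := ltn_ceil k q_gt0; nia.
  rewrite divn_small //; apply: leq_trans (trunc_log_ltn _ p_gt1) _.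
  by rewrite leq_pexp2l // prime_gt0.
rewrite !big_split /= in le_sum.
have : \sum_(1 <= j < (k.*2).+1) (j <= trunc_log p k.*2) <= trunc_log p k.*2.
  rewrite big_nat_cond -big_mkcondr /= sum1_count.
  set t := trunc_log _ _; rewrite -size_filter.
  apply: (@leq_trans (size (iota 1 t))); last by rewrite size_iota.
  apply: uniq_leq_size; first exact/filter_uniq/iota_uniq.
  by move=> j; rewrite mem_filter !mem_iota; lia.
lia.
Qed.

Lemma central_bin_ge k : 2 ^ k <= 'C(k.*2, k).
Proof.
elim: k => [|k IHk] //.
have e1 : k.+1 * 'C(k.+1.*2, k.+1) = k.+1.*2 * 'C(k.*2.+1, k).
  by rewrite doubleS -mul_bin_diag.
have e2 : k.*2.+1 * 'C(k.*2, k) = k.+1 * 'C(k.*2.+1, k).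
  by have := mul_bin_down k.*2.+1 k; have -> : k.*2.+1 - k = k.+1 by lia.
have e3 : 'C(k.+1.*2, k.+1) = 2 * 'C(k.*2.+1, k).
  by apply/eqP; rewrite -(@eqn_pmul2l k.+1) // e1 -mul2n; apply/eqP; lia.
have e4 : 'C(k.*2, k) <= 'C(k.*2.+1, k).
  by rewrite -(@leq_pmul2l k.+1) // -e2 leq_mul2r; apply/orP; right; lia.
by rewrite expnS e3 leq_mul2l (leq_trans IHk e4).
Qed.

(** With [k = z./2], compare [2^k <= 'C(2k, k) <= z^pi(z)], where [pi(z)] counts the primes up to
    [z], and bound [z] by a power of 2. The factor 3 comes from [z <= 2k + 1 <= 3k]. *)
Lemma chebyshev_lower z : 1 < z ->
  z <= 3 * ((trunc_log 2 z).+1 * size (primes_upto z)).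
Proof.
move=> z_gt1; pose k := z./2.
have k_gt0 : 0 < k by rewrite /k; lia.
have k2z : k.*2 <= z by rewrite /k; lia.
have bin_pos : 0 < 'C(k.*2, k) by rewrite bin_gt0; lia.
have sz : size (primes 'C(k.*2, k)) <= size (primes_upto z).
  apply: uniq_leq_size; first exact: primes_uniq.
  move=> p; rewrite mem_primes_upto mem_primes => /and3P[pr_p _ p_dv].
  rewrite pr_p; apply: leq_trans k2z.
  apply: leq_trans (pfactor_central_bin pr_p k_gt0).
  rewrite -{1}(expn1 p) leq_exp2l ?prime_gt1 // -pfactor_dvdn //.
have le_bin : 'C(k.*2, k) <= z ^ size (primes 'C(k.*2, k)).
  rewrite {1}(prod_primes_logn bin_pos); apply: leq_prod_expn => p.
  rewrite mem_primes => /and3P[pr_p _ _].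
  exact: leq_trans (pfactor_central_bin pr_p k_gt0) k2z.
have sz_gt0 : 0 < size (primes 'C(k.*2, k)).
  case: (size _) le_bin => // bin1; have := leq_trans (central_bin_ge k) bin1.
  by have := ltn_expl k (ltnSn 1); rewrite expn0; lia.
have : 2 ^ k <= 2 ^ ((trunc_log 2 z).+1 * size (primes_upto z)).
  apply: leq_trans (central_bin_ge k) _; apply: leq_trans le_bin _.
  rewrite expnM; apply: (@leq_trans (z ^ size (primes_upto z))).
    by rewrite leq_pexp2l //; lia.
  by rewrite leq_exp2r ?(leq_trans sz_gt0) // ltnW ?trunc_log_ltn.
by rewrite leq_exp2l // /k; lia.
Qed.

(** * Greedy covering *)

Lemma expn_addn_ge x d r : x ^ r.+1 + r.+1 * d * x ^ r <= (x + d) ^ r.+1.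
Proof.
elim: r => [|r IHr]; first by rewrite !expn1 expn0; lia.
rewrite [(x + d) ^ _]expnS; apply: leq_trans (leq_mul (leqnn _) IHr).
by rewrite !expnS; nia.
Qed.

(** Bernoulli's inequality: the first two terms in the expansion of [((N - D) + D)^r] are each at
    least [(N - D)^r], the second because [r D >= N - D]. *)
Lemma double_expn_subn N D r : 0 < N -> N <= r * D -> 2 * (N - D) ^ r <= N ^ r.
Proof.
case: r => [|r] N0 NrD; first by lia.
have [DN|/ltnW ND] := leqP D N; last by rewrite (eqP ND) exp0n // muln0.
have := expn_addn_ge (N - D) D r; rewrite subnK // => h.
apply: leq_trans h; rewrite expnS.
have : (N - D) * (N - D) ^ r <= r.+1 * D * (N - D) ^ r by rewrite leq_mul2r; lia.
lia.
Qed.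

Section Greedy.

Variables (T U : finType) (cov : U -> T -> bool) (bs : {set U}).

Definition uncovered (X : {set T}) (S : {set U}) :=
  [set x in X | [forall b in S, ~~ cov b x]].

(** Averaging: each [x] is missed by at most [#|bs| - D] elements of [bs], and the [b] that misses
    the fewest points does at least as well as the mean. *)
Lemma greedy_step (X : {set T}) D :
  (forall x, x \in X -> D <= #|[set b in bs | cov b x]|) -> 0 < #|bs| ->
  exists2 b, b \in bs & #|[set x in X | ~~ cov b x]| * #|bs| <= #|X| * (#|bs| - D).
Proof.
move=> covX bs_gt0.
have sum_le : \sum_(b in bs) #|[set x in X | ~~ cov b x]| <= #|X| * (#|bs| - D).
  have -> : \sum_(b in bs) #|[set x in X | ~~ cov b x]| =
            \sum_(x in X) #|[set b in bs | ~~ cov b x]|.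
    under eq_bigr do rewrite -sum1_card (eq_bigl _ _ (fun x => in_set _ x)) big_mkcondr /=.
    under [RHS]eq_bigr do rewrite -sum1_card (eq_bigl _ _ (fun x => in_set _ x)) big_mkcondr /=.
    exact: exchange_big.
  rewrite -sum_nat_const; apply: leq_sum => x Xx.
  have := covX x Xx; rewrite -(cardsID [set b | cov b x] bs).
  have -> : bs :&: [set b | cov b x] = [set b in bs | cov b x].
    by apply/setP => b; rewrite !inE.
  have -> : bs :\: [set b | cov b x] = [set b in bs | ~~ cov b x].
    by apply/setP => b; rewrite !inE andbC.
  lia.
have [b0 b0bs] : exists b, b \in bs by apply/set0Pn; rewrite -card_gt0.
case: (arg_minnP (fun b => #|[set x in X | ~~ cov b x]|) b0bs) => b bbs bmin.
exists b => //; apply: leq_trans sum_le; rewrite mulnC -sum_nat_const.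
exact: leq_sum.
Qed.

Lemma greedy_iter (X : {set T}) D t :
  (forall x, x \in X -> D <= #|[set b in bs | cov b x]|) -> 0 < #|bs| ->
  exists2 S : {set U}, #|S| <= t &
    #|uncovered X S| * #|bs| ^ t <= #|X| * (#|bs| - D) ^ t.
Proof.
move=> covX bs_gt0; elim: t => [|t [S St uS]].
  exists set0; first by rewrite cards0.
  rewrite !expn0 !muln1; apply/subset_leq_card/subsetP => x.
  by rewrite inE => /andP[].
have covS x : x \in uncovered X S -> D <= #|[set b in bs | cov b x]|.
  by rewrite inE => /andP[/covX].
have [b _ ub] := greedy_step covS bs_gt0.
exists (b |: S); first by rewrite cardsU1; case: (b \in S) => /=; lia.
have -> : uncovered X (b |: S) = [set x in uncovered X S | ~~ cov b x].
  apply/setP => x; rewrite !inE -andbA; congr (_ && _).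
  apply/forall_inP/andP => [h|[/forall_inP h1 h2] c].
    split; last by apply: h; rewrite !inE eqxx.
    by apply/forall_inP => c cS; apply: h; rewrite !inE cS orbT.
  by rewrite !inE => /orP[/eqP->|/h1].
rewrite !expnS mulnA.
apply: leq_trans (leq_mul ub (leqnn _)) _.
rewrite mulnAC [X in _ <= X]mulnCA [X in _ <= X]mulnC.
by rewrite leq_mul2r uS orbT.
Qed.

(** Every [r] greedy choices halve the uncovered part. After [r k] of them at most [#|X| %/ 2^k]
    points remain, and each gets a [b] of its own. *)
Lemma greedy_cover (X : {set T}) r D k : 0 < D -> #|bs| <= r * D ->
  (forall x, x \in X -> D <= #|[set b in bs | cov b x]|) ->
  exists S : {set U}, #|S| <= r * k + #|X| %/ 2 ^ k /\
    forall x, x \in X -> exists2 b, b \in S & cov b x.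
Proof.
move=> D_gt0 bs_rD covX.
have [->|[x0 Xx0]] := set_0Vmem X.
  by exists set0; rewrite cards0; split=> // x; rewrite inE.
have bs_gt0 : 0 < #|bs|.
  apply: leq_trans D_gt0 _; apply: leq_trans (covX _ Xx0) _.
  by apply/subset_leq_card/subsetP => b; rewrite inE => /andP[].
have [S Srk uS] := greedy_iter (r * k) covX bs_gt0.
have halves : 2 ^ k * (#|bs| - D) ^ (r * k) <= #|bs| ^ (r * k).
  rewrite !expnM -expnMn; case: (posnP k) => [->|k_gt0]; first by rewrite !expn0.
  by rewrite leq_exp2r // double_expn_subn.
have u_small : #|uncovered X S| <= #|X| %/ 2 ^ k.
  rewrite leq_divRL ?expn_gt0 // -(@leq_pmul2r (#|bs| ^ (r * k))) ?expn_gt0 ?bs_gt0 //.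
  rewrite mulnAC; apply: leq_trans (leq_mul uS (leqnn _)) _.
  by rewrite -mulnA leq_mul2l [_ * 2 ^ k]mulnC halves orbT.
have pickb x : exists b, (x \in X) ==> cov b x.
  have [Xx|_] := boolP (x \in X); last by case/card_gt0P: bs_gt0 => b _; exists b.
  have := leq_trans D_gt0 (covX x Xx); rewrite card_gt0 => /set0Pn[b].
  by rewrite inE => /andP[_ cb]; exists b.
pose f x := xchoose (pickb x).
exists (S :|: f @: uncovered X S); split.
  apply: leq_trans (leq_card_setU _ _) _; apply: leq_add => //.
  exact: leq_trans (leq_imset_card _ _) u_small.
move=> x Xx; have [ux|] := boolP (x \in uncovered X S).
  exists (f x); first by rewrite inE imset_f ?orbT.
  by apply: (implyP (xchooseP (pickb x))).
rewrite inE Xx /= negb_forall => /existsP[b]; rewrite negb_imply negbK.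
by case/andP=> bS cb; exists b => //; rewrite inE bS.
Qed.

End Greedy.

(** * The orbits of the units of [Z_n] *)

Definition coprimes_upto (m y : nat) : seq nat := [seq a <- iota 1 y | coprime a m].

Lemma mem_coprimes_upto m y a :
  (a \in coprimes_upto m y) = [&& 0 < a, a <= y & coprime a m].
Proof. by rewrite mem_filter mem_iota add1n ltnS andbC andbA. Qed.

Lemma uniq_coprimes_upto m y : uniq (coprimes_upto m y).
Proof. exact/filter_uniq/iota_uniq. Qed.

Lemma coprime_mod_eq m u v : u = v %[mod m] -> coprime u m = coprime v m.
Proof. by move=> uv; rewrite -coprime_modl uv coprime_modl. Qed.

Lemma prime_coprimeP m n : 0 < n ->
  (forall p, prime p -> p %| m -> p %| n -> False) -> coprime m n.
Proof.
move=> n_gt0 no_p; have g_gt0 : 0 < gcdn m n by rewrite gcdn_gt0 n_gt0 orbT.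
rewrite /coprime eqn_leq g_gt0 andbT leqNgt; apply/negP => /pdivP[p pr_p].
by rewrite dvdn_gcd => /andP[pm pn]; apply: (no_p p).
Qed.

Lemma coprime_prime_dvd p m n : prime p -> coprime m n -> p %| m -> p %| n -> False.
Proof.
move=> pr_p /eqP cmn pm pn.
have : p %| gcdn m n by rewrite dvdn_gcd pm pn.
by rewrite cmn dvdn1 => /eqP p1; rewrite p1 in pr_p.
Qed.

Lemma coprime_lift m n u : 0 < n -> m %| n -> coprime u m ->
  exists2 g, coprime g n & g = u %[mod m].
Proof.
move=> n_gt0 mn cum; have m_gt0 := dvdn_gt0 n_gt0 mn.
pose r := n`_(\pi(m)^'); have cmr : coprime m r.
  by rewrite -{1}(@part_pnat_id \pi(m) m) ?pnat_pi // coprime_partC.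
exists (chinese m r u 1); last by rewrite chinese_modl.
set g := chinese _ _ _ _.
have cgm : coprime g m by rewrite (@coprime_mod_eq m g u) ?chinese_modl.
have cgr : coprime g r by rewrite (@coprime_mod_eq r g 1) ?coprime1n ?chinese_modr.
apply: prime_coprimeP => // p pr_p pg pn.
have pNm : ~~ (p %| m).
  by apply/negP => pm; apply: (coprime_prime_dvd pr_p cgm).
apply: (coprime_prime_dvd pr_p cgr) => //.
rewrite -(@part_pnat_id \pi(m)^' p) ?partn_dvd //.
by rewrite pnatE // !inE /= mem_primes negb_and pr_p m_gt0 /= pNm.
Qed.

Section Classes.

Variable n : nat.
Hypothesis n_gt0 : 0 < n.

Definition gcd_class (d : nat) : {set 'I_n} := [set x : 'I_n | gcdn x n == d].

Definition covers (l : nat) (b x : 'I_n) : bool :=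
  [exists a : 'I_l.+1, (a * b) %% n == x].

Definition ordmod (x : nat) : 'I_n := Ordinal (ltn_pmod x n_gt0).

Lemma coversP l (b x : 'I_n) a : a <= l -> (a * b) %% n = x -> covers l b x.
Proof. by move=> al abx; apply/existsP; exists (Ordinal (al : a < l.+1)); rewrite /= abx. Qed.

Lemma gcd_classP d m (x : 'I_n) : n = d * m ->
  reflect (exists2 y, x = d * y :> nat & coprime y m) (x \in gcd_class d).
Proof.
move=> nE; have d_gt0 : 0 < d by move: n_gt0; rewrite nE muln_gt0 => /andP[].
rewrite inE; apply: (iffP eqP) => [gd|[y xE cym]].
  have dx : d %| x by rewrite -gd dvdn_gcdl.
  exists (x %/ d); first by rewrite mulnC divnK.
  move: gd; rewrite -{1}(divnK dx) [X in gcdn _ X]nE [_ * d]mulnC -muln_gcdr => /eqP.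
  by rewrite -[X in _ == X]muln1 eqn_pmul2l.
by rewrite xE nE -muln_gcdr (eqP cym) muln1.
Qed.

Lemma gcd_class_transitive d (x x' : 'I_n) : d %| n ->
  x \in gcd_class d -> x' \in gcd_class d ->
  exists2 g, coprime g n & x' = (g * x) %% n :> nat.
Proof.
move=> /dvdnP[m]; rewrite mulnC => nE /(gcd_classP _ nE)[y xE cym].
move=> /(gcd_classP _ nE)[y' xE' cym'].
have m_gt0 : 0 < m by move: n_gt0; rewrite nE muln_gt0 => /andP[].
have cmy : coprime m y by rewrite coprime_sym.
(* This divides [y'] by [y] modulo [m]: [z] is congruent to [y'] modulo [m] and a multiple [u y] of
   [y], so [u] is the required unit modulo [m]. *)
pose z := chinese m y y' 0.
have zm : z = y' %[mod m] by rewrite /z chinese_modl.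
have /dvdnP[u zE] : y %| z by rewrite /dvdn /z chinese_modr // mod0n.
have cum : coprime u m.
  have := coprime_mod_eq zm; rewrite cym' zE coprimeMl => /andP[] //.
have mn : m %| n by rewrite nE dvdn_mull.
have [g cgn gu] := coprime_lift n_gt0 mn cum; exists g => //.
have -> : (g * x) %% n = d * (g * y %% m) by rewrite xE muln_modr -nE mulnCA.
by rewrite -modnMml gu modnMml -zE zm muln_modr -nE -xE' modn_small.
Qed.

(** If [x' = g x] with [g] a unit, multiplication by [g] preserves the class of [e] and sends the
    [b] covering [x] injectively to elements covering [x']. *)
Lemma card_covers_const l d e (x x' : 'I_n) : d %| n ->
  x \in gcd_class d -> x' \in gcd_class d ->
  #|[set b in gcd_class e | covers l b x]| <= #|[set b in gcd_class e | covers l b x']|.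
Proof.
move=> dn xd x'd; have [g cgn gx] := gcd_class_transitive dn xd x'd.
rewrite -(@card_in_imset _ _ (fun b : 'I_n => ordmod (g * b))).
  apply/subset_leq_card/subsetP => c /imsetP[b]; rewrite !inE => /andP[be bx] ->.
  rewrite gcdn_modl gcdnC Gauss_gcdr 1?coprime_sym // gcdnC be /=.
  case/existsP: bx => a /eqP ax; apply: (@coversP _ _ _ a); first by rewrite -ltnS.
  by rewrite /= modnMmr mulnCA -modnMmr ax.
move=> b b' _ _ /(congr1 val) /= /eqP.
have inj (i j : 'I_n) : i <= j -> g * i == g * j %[mod n] -> i = j.
  move=> ij; rewrite eq_sym eqn_mod_dvd ?leq_mul2l ?ij ?orbT // -mulnBr.
  rewrite Gauss_dvdr 1?coprime_sym // => /dvdn_leq dv; apply/val_inj/eqP => /=.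
  rewrite eqn_leq ij leqNgt; apply/negP => ji; have := dv; rewrite subn_gt0 ji.
  by have := ltn_ord j; lia.
case: (leqP b b') => [bb|/ltnW bb]; first exact: inj.
by rewrite eq_sym => /(inj _ _ bb).
Qed.

(** Write [b = e b1]. The multiples [f a b] with [a <= y] coprime to [m] equal [e f (a b1 %% m)];
    they are distinct because [b1] is a unit modulo [m] and [y <= m]. *)
Lemma card_covered_ge l e f m y (b : 'I_n) : n = e * f * m -> f * y <= l -> y <= m ->
  b \in gcd_class e ->
  size (coprimes_upto m y) <= #|[set x in gcd_class (e * f) | covers l b x]|.
Proof.
move=> nE fyl ym be; have nE' : n = e * (f * m) by rewrite nE mulnA.
have [b1 bE cb] := gcd_classP _ nE' be.
have ef_gt0 : 0 < e * f by move: n_gt0; rewrite nE muln_gt0 => /andP[].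
have m_gt0 : 0 < m by move: n_gt0; rewrite nE muln_gt0 => /andP[].
have cbm : coprime b1 m by move: cb; rewrite coprimeMr => /andP[].
pose F a := ordmod (f * a * b).
have FE a : F a = e * f * (a * b1 %% m) :> nat.
  by rewrite muln_modr -nE /= bE; congr (_ %% _); lia.
rewrite -(size_map F) cardE; apply: uniq_leq_size; last first.
  move=> x /mapP[a]; rewrite mem_coprimes_upto => /and3P[a0 ay cam] ->.
  rewrite mem_enum inE; apply/andP; split.
    apply/(gcd_classP _ nE); exists (a * b1 %% m); first exact: FE.
    by rewrite coprime_modl coprimeMl cam.
  by apply: (@coversP _ _ _ (f * a)) => //; apply: leq_trans fyl; rewrite leq_mul2l ay orbT.
rewrite map_inj_in_uniq ?uniq_coprimes_upto // => a a'.
rewrite !mem_coprimes_upto => /and3P[a0 ay _] /and3P[a'0 a'y _] /(congr1 val) /=.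
rewrite -[LHS]/(F a : nat) -[RHS]/(F a' : nat) !FE => /eqP.
rewrite eqn_pmul2l // => aa.
have inj i j : 0 < i -> i <= j -> j <= y -> i * b1 == j * b1 %[mod m] -> i = j.
  move=> i0 ij jy; rewrite eq_sym eqn_mod_dvd ?leq_mul2r ?ij ?orbT // -mulnBl.
  rewrite Gauss_dvdl 1?coprime_sym // => /dvdn_leq dv.
  by case: (posnP (j - i)) => [|/dv]; lia.
case: (leqP a a') => [le|/ltnW le]; first exact: inj.
by apply/esym; apply: inj => //; rewrite eq_sym.
Qed.

(** Double counting of the covering pairs between the two classes: [card_covered_ge] bounds the
    count from each [b], and the count at [x'] does not depend on [x']. *)
Lemma card_covers_ge l e f m y (x : 'I_n) : n = e * f * m -> f * y <= l -> y <= m ->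
  x \in gcd_class (e * f) ->
  #|gcd_class e| * size (coprimes_upto m y) <=
  #|gcd_class (e * f)| * #|[set b in gcd_class e | covers l b x]|.
Proof.
move=> nE fyl ym xd; have dn : e * f %| n by rewrite nE dvdn_mulr.
rewrite -!sum_nat_const.
apply: (@leq_trans (\sum_(b in gcd_class e) #|[set x' in gcd_class (e * f) | covers l b x']|)).
  by apply: leq_sum => b be; apply: (card_covered_ge nE).
have -> : \sum_(b in gcd_class e) #|[set x' in gcd_class (e * f) | covers l b x']| =
          \sum_(x' in gcd_class (e * f)) #|[set b in gcd_class e | covers l b x']|.
  under eq_bigr do rewrite -sum1_card (eq_bigl _ _ (fun x => in_set _ x)) big_mkcondr /=.
  under [RHS]eq_bigr do rewrite -sum1_card (eq_bigl _ _ (fun x => in_set _ x)) big_mkcondr /=.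
  exact: exchange_big.
by apply: leq_sum => x' x'd; apply: (card_covers_const _ _ dn).
Qed.

Lemma card_gcd_class_totient d m : n = d * m -> #|gcd_class d| <= totient m.
Proof.
move=> nE; have m_gt0 : 0 < m by move: n_gt0; rewrite nE muln_gt0 => /andP[].
have d_gt0 : 0 < d by move: n_gt0; rewrite nE muln_gt0 => /andP[].
rewrite totient_count_coprime -big_mkcond /= sum1_count -size_filter cardE.
rewrite -(size_map (fun x : 'I_n => x %/ d)); apply: uniq_leq_size.
  rewrite map_inj_in_uniq ?enum_uniq // => x x'; rewrite !mem_enum.
  move=> /(gcd_classP _ nE)[y xE _] /(gcd_classP _ nE)[y' xE' _].
  by rewrite xE xE' !mulKn // => yy; apply/val_inj => /=; rewrite xE xE' yy.
move=> z /mapP[x]; rewrite mem_enum => /(gcd_classP _ nE)[y xE cym] ->.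
rewrite mem_filter mem_index_iota xE mulKn // coprime_sym cym /=.
by have := ltn_ord x; rewrite xE [X in _ < X]nE ltn_pmul2l.
Qed.

Lemma sum_card_gcd_class (s : seq nat) : uniq s -> \sum_(d <- s) #|gcd_class d| <= n.
Proof.
move=> us; under eq_bigr do rewrite -sum1_card (eq_bigl _ _ (fun x => in_set _ x)) big_mkcond /=.
rewrite exchange_big /=.
apply: (@leq_trans (\sum_(x < n) 1)); last by rewrite sum_nat_const card_ord muln1.
apply: leq_sum => x _.
rewrite -big_mkcond sum1_count /=.
have -> : count (fun i => gcdn x n == i) s = count_mem (gcdn x n) s.
  by apply: eq_count => i; rewrite /= eq_sym.
by rewrite count_uniq_mem // leq_b1.
Qed.

End Classes.

(** * Integers coprime to [m] *)

Section WeightedSums.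

Local Open Scope ring_scope.

Variable R : realFieldType.

Lemma ler_sum_sub (T : eqType) (s t : seq T) (F : T -> R) :
  uniq s -> uniq t -> {subset s <= t} -> (forall i, 0 <= F i) ->
  \sum_(i <- s) F i <= \sum_(i <- t) F i.
Proof.
move=> us ut st F0.
have ps : perm_eq s [seq i <- t | i \in s].
  apply: uniq_perm; rewrite ?filter_uniq // => i; rewrite mem_filter.
  by case si: (i \in s) => //=; rewrite st.
rewrite (perm_big _ ps) big_filter big_mkcond /=; apply: ler_sum => i _.
by case: ifP.
Qed.

Lemma ler_sum_pred (T : eqType) (s : seq T) (P Q : pred T) (F : T -> R) :
  {in s, forall i, P i -> Q i} -> (forall i, 0 <= F i) ->
  \sum_(i <- s | P i) F i <= \sum_(i <- s | Q i) F i.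
Proof.
move=> PQ F0; rewrite big_seq_cond [leRHS]big_seq_cond !(big_mkcond (fun _ => _ && _)) /=.
apply: ler_sum => i _; have [si|] //= := boolP (i \in s).
by have := PQ i si; case: (P i) => [->//|_]; case: (Q i).
Qed.

(** A completely multiplicative weight: [1 / j] for the sieve, [1 / sqrt j] for Rankin's trick. *)
Variable f : nat -> R.
Hypotheses (f_ge0 : forall i, 0 <= f i) (fM : {morph f : i j / (i * j)%N >-> i * j}).

Lemma sum_multiples_le p N (P Q : pred nat) : (0 < p)%N ->
  (forall i, (0 < i)%N -> P (p * i)%N -> Q i) ->
  \sum_(j <- iota 1 N | (p %| j)%N && P j) f j <= f p * \sum_(i <- iota 1 N | Q i) f i.
Proof.
move=> p_gt0 PQ; rewrite mulr_sumr.
under [leRHS]eq_bigr do rewrite -fM.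
rewrite -[leLHS]big_filter -[leRHS]big_filter -[leRHS](big_map (muln p) xpredT).
apply: ler_sum_sub => //; first exact/filter_uniq/iota_uniq.
  rewrite map_inj_uniq; first exact/filter_uniq/iota_uniq.
  by move=> i j /eqP; rewrite eqn_pmul2l // => /eqP.
move=> j; rewrite mem_filter mem_iota => /andP[/andP[/dvdnP[i ->] Pj] jN].
apply/mapP; exists i; last exact: mulnC.
rewrite mem_filter mem_iota; apply/andP; split; last by nia.
by apply: PQ; [nia|rewrite mulnC].
Qed.

(** Sieving by one more prime [p] removes the terms [j = p i], whose weight is at most [f p] times
    the current sum, so a factor [1 - f p] survives. *)
Lemma coprime_sum_ge (s : seq nat) N : {in s, forall p, prime p /\ f p <= 1} ->
  (\prod_(p <- s) (1 - f p)) * \sum_(j <- iota 1 N) f j <=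
  \sum_(j <- iota 1 N | all (fun p => ~~ (p %| j)%N) s) f j.
Proof.
elim: s => [|p s IHs] ps; first by rewrite big_nil mul1r.
have [pr_p fp] := ps p (mem_head _ _).
have ps' : {in s, forall p, prime p /\ f p <= 1}.
  by move=> q sq; apply: ps; rewrite inE sq orbT.
have {}IHs := IHs ps'.
set A := \sum_(j <- iota 1 N | all _ s) f j in IHs.
have split_A : A = \sum_(j <- iota 1 N | (p %| j)%N && all (fun p => ~~ (p %| j)%N) s) f j +
   \sum_(j <- iota 1 N | all (fun p => ~~ (p %| j)%N) (p :: s)) f j.
  rewrite /A (bigID (fun j => (p %| j)%N)) /=; congr (_ + _).
    by apply: eq_bigl => j; rewrite andbC.
  by apply: eq_bigl => j; rewrite andbC.
have mult : \sum_(j <- iota 1 N | (p %| j)%N && all (fun p => ~~ (p %| j)%N) s) f j <= f p * A.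
  apply: sum_multiples_le; first exact: prime_gt0.
  move=> i _ /allP h; apply/allP => q sq; apply: contra (h q sq).
  exact: dvdn_mull.
rewrite big_cons -mulrA.
have : (1 - f p) * ((\prod_(p <- s) (1 - f p)) * \sum_(j <- iota 1 N) f j) <= (1 - f p) * A.
  by apply: ler_wpM2l => //; rewrite subr_ge0.
lra.
Qed.

(** A truncated Euler product. If [A] is the sum for [p :: s] and [A'] that for [s], splitting off
    the multiples of [p] gives [A <= f p * A + A']. *)
Lemma smooth_sum_le (s : seq nat) N : f 1 = 1 -> {in s, forall p, prime p /\ f p <= 1} ->
  (\prod_(p <- s) (1 - f p)) * \sum_(j <- iota 1 N | all (mem s) (primes j)) f j <= 1.
Proof.
move=> f1; elim: s => [|p s IHs] ps.
  rewrite big_nil mul1r -big_filter.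
  apply: (@le_trans _ _ (\sum_(j <- [:: 1%N]) f j)); last by rewrite big_seq1 f1.
  apply: ler_sum_sub => //; first exact/filter_uniq/iota_uniq.
  move=> j; rewrite mem_filter mem_iota => /andP[/allP pj j1].
  rewrite inE eqn_leq; apply/andP; split; last by lia.
  rewrite leqNgt; apply/negP => /pdivP[q pr_q qj].
  by have /pj : q \in primes j by rewrite mem_primes pr_q qj; lia.
have [pr_p fp] := ps p (mem_head _ _).
have ps' : {in s, forall p, prime p /\ f p <= 1}.
  by move=> q sq; apply: ps; rewrite inE sq orbT.
have {}IHs := IHs ps'.
set A' := \sum_(j <- _ | _) _ in IHs.
set A := \sum_(j <- _ | _) _.
have A_le : A <= f p * A + A'.
  rewrite {1}/A (bigID (fun j => (p %| j)%N)) /=; apply: lerD.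
    under eq_bigl do rewrite andbC.
    apply: sum_multiples_le; first exact: prime_gt0.
    move=> i i0 /allP h; apply/allP => q qi; apply: h.
    by move: qi; rewrite !mem_primes muln_gt0 i0 prime_gt0 // => /and3P[-> _ /dvdn_mull->].
  apply: ler_sum_pred => // j _ /andP[/allP h pNj]; apply/allP => q qj.
  have := h q qj; rewrite inE => /orP[/eqP qp|//].
  by move: qj pNj; rewrite mem_primes qp => /and3P[_ _ ->].
have prod_ge0 : 0 <= \prod_(p <- s) (1 - f p).
  by rewrite big_seq; apply: prodr_ge0 => q /ps'[_]; rewrite subr_ge0.
rewrite big_cons; apply: le_trans IHs.
have : (\prod_(p <- s) (1 - f p)) * A <= (\prod_(p <- s) (1 - f p)) * (f p * A + A').
  exact: ler_wpM2l.
lra.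
Qed.

End WeightedSums.

(** * The totient as a product, the harmonic sum, and the sieve bound *)

Section Sieve.

Local Open Scope ring_scope.

Lemma totient_prod (m : nat) : (0 < m)%N ->
  (totient m)%:R = m%:R * \prod_(p <- primes m) (1 - (p%:R)^-1 : rat).
Proof.
move=> m_gt0; rewrite {2}(prod_primes_logn m_gt0) totientE // !natr_prod -big_split /=.
apply: eq_big_seq => p; rewrite mem_primes => /and3P[pr_p _ pm].
have p_gt0 := prime_gt0 pr_p.
have lp : (0 < logn p m)%N by rewrite logn_gt0 mem_primes pr_p m_gt0.
rewrite -{2}(prednK lp) expnS !natrM mulrAC; congr (_ * _).
rewrite mulrBr mulr1 divff ?pnatr_eq0 -?lt0n //.
by rewrite -{2}(prednK p_gt0) -natr1 addrK.
Qed.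

(** Each dyadic block from [2^k + 1] to [2^k.+1] contributes at least 1/2. *)
Lemma harmonic_ge k : (k.+1)%:R / 2 <= \sum_(j <- iota 1 (2 ^ k)) (j%:R^-1 : rat).
Proof.
elim: k => [|k IHk]; first by rewrite expn0 big_seq1 invr1; lra.
rewrite expnS mul2n -addnn iotaD big_cat /=.
have : 1 / 2 <= \sum_(j <- iota (1 + 2 ^ k) (2 ^ k)) (j%:R^-1 : rat).
  apply: (@le_trans _ _ (\sum_(j <- iota (1 + 2 ^ k) (2 ^ k)) ((2 ^ k.+1)%:R^-1 : rat))).
    rewrite big_const_seq count_predT size_iota iter_addr_0 expnS natrM.
    have : (2 ^ k)%:R != 0 :> rat by rewrite pnatr_eq0 expn_eq0.
    rewrite -[leRHS]mulr_natl; move: (2 ^ k)%:R => x x0.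
    by rewrite le_eqVlt; apply/orP; left; apply/eqP; field.
  rewrite big_seq [leRHS]big_seq; apply: ler_sum => j; rewrite mem_iota => jk.
  have j_gt0 : (0 < j)%N by lia.
  rewrite lef_pV2 ?posrE ?ltr0n ?expn_gt0 // ler_nat expnS.
  by move: jk; set q := (2 ^ k)%N; lia.
by move: IHk; rewrite -[k.+2%:R]natr1; lra.
Qed.

End Sieve.

Lemma size_primes_avoid z w m : 0 < m -> size (primes_upto z) <=
  size [seq q <- primes_upto z | (w < q) && ~~ (q %| m)] + w +
  size [seq p <- primes m | w < p].
Proof.
move=> m_gt0; rewrite -[X in _ + X + _](size_iota 1) -!size_cat.
apply: uniq_leq_size; first exact: uniq_primes_upto.
move=> q; rewrite !mem_cat !mem_filter => /andP[pr_q ->].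
rewrite mem_iota mem_primes m_gt0 pr_q prime_gt0 //= add1n ltnS andbT.
by case: (leqP q w) => qw; rewrite ?orbT //=; case: (q %| m); rewrite ?orbT.
Qed.

(** The products [j q] are distinct: if [j q = j' q'], then [q] divides [j' q'] but is larger than
    [j'], so [q = q']. *)
Lemma coprime_mul_prime_count m y M : 0 < m -> 0 < M ->
  \sum_(j <- coprimes_upto m M)
    size [seq q <- primes_upto (y %/ j) | (M < q) && ~~ (q %| m)] <=
  size (coprimes_upto m y).
Proof.
move=> m_gt0 M_gt0.
pose Pj j := [seq q <- primes_upto (y %/ j) | (M < q) && ~~ (q %| m)].
pose prods := [seq j * q | j <- coprimes_upto m M, q <- Pj j].
have -> : \sum_(j <- coprimes_upto m M) size (Pj j) = size prods.
  by rewrite size_allpairs_dep sumnE big_map.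
have PjP j q : q \in Pj j -> [/\ prime q, q <= y %/ j, M < q & ~~ (q %| m)].
  by rewrite mem_filter mem_primes_upto => /andP[/andP[? ?] /andP[? ?]].
apply: uniq_leq_size.
  apply: allpairs_uniq_dep; first exact: uniq_coprimes_upto.
    by move=> j _; apply/filter_uniq/uniq_primes_upto.
  move=> u v /allpairsPdep[j [q [jM /PjP[pr_q _ Mq _] ->]]].
  move=> /allpairsPdep[j' [q' [jM' /PjP[pr_q' _ Mq' _] ->]]] /= eq_jq.
  move: jM jM'; rewrite !mem_coprimes_upto => /and3P[j0 jM _] /and3P[j'0 j'M _].
  have qq' : q = q'.
    have : q %| j' * q' by rewrite -eq_jq dvdn_mull.
    rewrite Euclid_dvdM // => /orP[/(dvdn_leq j'0)|]; first by lia.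
    by rewrite dvdn_prime2 // => /eqP.
  by rewrite qq' in eq_jq *; congr existT; apply/eqP; rewrite -(@eqn_pmul2r q') ?eq_jq //; lia.
move=> a /allpairsPdep[j [q [jM /PjP[pr_q qy Mq qm] ->]]].
move: jM; rewrite !mem_coprimes_upto => /and3P[j0 jM cjm].
have q0 := prime_gt0 pr_q.
rewrite muln_gt0 j0 q0 coprimeMl cjm prime_coprime // qm andbT /=.
by move: qy; rewrite andbT leq_divRL // mulnC.
Qed.

(** Here [M = 2^k] is about [y^(1/4)]. Chebyshev at [y %/ j] gives [y <= 24 k.+1 j (#|P| + 5 M^2)],
    where [5 M^2] covers the primes up to [M] and the prime divisors of [m]. Their share is at most
    [y / 2], which turns 24 into 48. *)
Lemma sieve_prime_count m y k j : 0 < m -> 12 <= k ->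
  (2 ^ k) ^ 4 <= y -> trunc_log 2 y < 4 * k.+1 -> size (primes m) ^ 2 <= y ->
  0 < j <= 2 ^ k ->
  y <= 48 * k.+1 * j * size [seq q <- primes_upto (y %/ j) | (2 ^ k < q) && ~~ (q %| m)].
Proof.
move=> m_gt0 k12; set M := 2 ^ k => My ty om /andP[j0 jM].
set P := [seq q <- _ | _]; set z := y %/ j.
(* Here 240 is [2 * 24 * 5], as needed for the excluded primes to cost at most half of [y]. *)
have kM : 240 * k.+1 <= M.
  rewrite /M -(subnK k12); elim: (k - 12) => [|i IHi]; first by [].
  by rewrite addSn expnS; lia.
have M_gt1 : 240 <= M by lia.
have jy : j <= y.
  apply: leq_trans jM _; apply: leq_trans My.
  by rewrite -{1}(expn1 M) leq_pexp2l //; lia.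
have yz : y <= 2 * (j * z).
  have := ltn_ceil y j0; rewrite -/z.
  have : 0 < z by rewrite divn_gt0.
  nia.
have M3z : 2 <= z.
  rewrite /z leq_divRL //; apply: leq_trans My; rewrite expnS.
  apply: (@leq_trans (M * M)); first by nia.
  by rewrite leq_mul2l expnS leq_pmulr ?orbT // expn_gt0; lia.
have cheb := chebyshev_lower M3z.
have tz : trunc_log 2 z <= trunc_log 2 y by apply: leq_trunc_log; apply: leq_div.
have avoid := size_primes_avoid z M m_gt0; rewrite -/P in avoid.
have om' : size [seq p <- primes m | M < p] <= 4 * M ^ 2.
  apply: (@leq_trans (size (primes m))); first by rewrite size_filter count_size.
  rewrite -(@leq_exp2r _ _ 2) //; apply: leq_trans om _.
  apply: ltnW; apply: leq_trans (trunc_log_ltn y (ltnSn 1)) _.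
  apply: (@leq_trans (2 ^ (4 * k.+1))); first by rewrite leq_exp2l.
  rewrite /M expnMn -!expnM -[4 ^ 2]/(2 ^ 4) -expnD leq_exp2l //; lia.
have pi_le : size (primes_upto z) <= size P + 5 * M ^ 2.
  apply: leq_trans avoid _; rewrite -addnA leq_add2l -[5]/(1 + 4) mulnDl mul1n.
  by apply: leq_add => //; rewrite -{1}(expn1 M) leq_pexp2l //; lia.
have y_le : y <= 24 * k.+1 * j * (size P + 5 * M ^ 2).
  apply: (leq_trans yz).
  have z12 : z <= 12 * k.+1 * size (primes_upto z).
    apply: leq_trans cheb _; rewrite mulnA leq_mul2r; apply/orP; right; lia.
  have : j * z <= j * (12 * k.+1 * (size P + 5 * M ^ 2)).
    rewrite leq_mul2l; apply/orP; right; apply: leq_trans z12 _.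
    by rewrite leq_mul2l pi_le orbT.
  lia.
have half : 240 * k.+1 * j * M ^ 2 <= y.
  apply: leq_trans My; rewrite (expnD M 2 2) leq_mul2r; apply/orP; right.
  by rewrite expnS expn1 leq_mul.
lia.
Qed.

(** Summing [sieve_prime_count] over [j <= M] coprime to [m] gives at least [y / (48 k.+1)] times
    the sum of [1 / j], which is at least [(totient m / m) (k.+1 / 2)]. The factor [k.+1] cancels.
    The bound [2^48] ensures [k >= 12]. *)
Lemma sieve_lower m y : 0 < m -> 2 ^ 48 <= y -> size (primes m) ^ 2 <= y ->
  y * totient m <= 96 * m * size (coprimes_upto m y).
Proof.
move=> m_gt0 y48 om; pose k := trunc_log 2 y %/ 4; pose M := 2 ^ k.
have y_gt0 : 0 < y by apply: leq_trans y48; rewrite expn_gt0.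
have t48 : 48 <= trunc_log 2 y by apply: trunc_log_max.
have k12 : 12 <= k by rewrite /k leq_divRL.
have My : M ^ 4 <= y.
  apply: leq_trans (trunc_logP (ltnSn 1) y_gt0).
  by rewrite -expnM leq_exp2l // leq_trunc_div.
have ty : trunc_log 2 y < 4 * k.+1 by rewrite mulnC ltn_ceil.
have M_gt0 : 0 < M by rewrite expn_gt0.
have count := coprime_mul_prime_count y m_gt0 M_gt0.
clear y48.
suff : (y%:R * (totient m)%:R <= 96%:R * m%:R * (size (coprimes_upto m y))%:R :> rat)%R.
  by rewrite -natrM -natrM -natrM ler_nat.
rewrite (totient_prod m_gt0).
set pr := (\prod_(p <- _) _)%R.
have pr_H := @coprime_sum_ge rat (fun j => j%:R^-1)%R _ _ (primes m) M _.
have {pr_H} H : (pr * \sum_(j <- iota 1 M) (j%:R^-1) <=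
    \sum_(j <- coprimes_upto m M) (j%:R^-1 : rat))%R.
  apply: le_trans (pr_H _ _ _) _.
  - by move=> i; rewrite invr_ge0.
  - by move=> i j; rewrite natrM invfM.
  - move=> p; rewrite mem_primes => /and3P[pr_p _ _]; split=> //.
    by rewrite invf_le1 ?ler1n ?ltr0n prime_gt0.
  rewrite -big_filter; apply: ler_sum_sub; rewrite ?uniq_coprimes_upto //.
  - exact/filter_uniq/iota_uniq.
  - move=> j; rewrite mem_filter mem_iota mem_coprimes_upto => /andP[/allP h jM].
    apply/and3P; split; [lia|lia|]; apply: prime_coprimeP => // p pr_p pj pm.
    by have /h : p \in primes m; rewrite ?mem_primes ?pr_p ?m_gt0 ?pm ?pj.
  - by move=> i; rewrite invr_ge0.
have hk := harmonic_ge k; rewrite -/M in hk.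
have pr_ge0 : (0 <= pr)%R.
  rewrite /pr big_seq; apply: prodr_ge0 => p; rewrite mem_primes => /and3P[pr_p _ _].
  by rewrite subr_ge0 invf_le1 ?ler1n ?ltr0n prime_gt0.
have [c cE] : {c | c = 48 * k.+1} by exists (48 * k.+1).
have sz : (y%:R * \sum_(j <- coprimes_upto m M) (j%:R^-1 : rat) <=
    c%:R * (size (coprimes_upto m y))%:R)%R.
  apply: (@le_trans _ _ (c%:R * (\sum_(j <- coprimes_upto m M)
    size [seq q <- primes_upto (y %/ j) | (M < q) && ~~ (q %| m)])%:R)%R); last first.
    by apply: ler_wpM2l; [exact: ler0n|rewrite ler_nat].
  rewrite natr_sum !mulr_sumr big_seq [leRHS]big_seq; apply: ler_sum => j.
  rewrite mem_coprimes_upto => /and3P[j0 jM _].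
  rewrite ler_pdivrMr ?ltr0n // mulrAC -!natrM ler_nat cE.
  by apply: sieve_prime_count => //; rewrite j0.
have step : (pr * (k.+1%:R / 2) * y%:R <= c%:R * (size (coprimes_upto m y))%:R)%R.
  apply: le_trans sz; rewrite [leRHS]mulrC; apply: ler_wpM2r => //.
  by apply: le_trans H; apply: ler_wpM2l.
rewrite cE natrM in step.
have {}step : (pr * y%:R <= 96 * (size (coprimes_upto m y))%:R)%R.
  rewrite -(@ler_pM2l _ (k.+1%:R : rat)) ?ltr0n //; lra.
have : (m%:R * (pr * y%:R) <= m%:R * (96 * (size (coprimes_upto m y))%:R) :> rat)%R.
  exact: ler_wpM2l.
lra.
Qed.

(** * Rankin's trick for divisors *)

Lemma size_primes_le_log n : 0 < n -> size (primes n) <= trunc_log 2 n.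
Proof.
move=> n_gt0; apply: trunc_log_max => //.
rewrite [leqRHS](prod_primes_logn n_gt0); apply: expn_leq_prod => p.
rewrite mem_primes => /and3P[pr_p _ pn]; apply: leq_trans (prime_gt1 pr_p) _.
rewrite -{1}(expn1 p); apply: leq_pexp2l; first exact: prime_gt0.
by rewrite logn_gt0 mem_primes pr_p n_gt0.
Qed.

Section Rankin.

Local Open Scope ring_scope.

(* [e] stands for the exponential, of which only the three properties below matter. *)
Variables (R : rcfType) (e : R -> R).
Hypotheses (e_ge1D : forall x, 1 + x <= e x) (eD : forall x y, e (x + y) = e x * e y).
Hypothesis e1_le : e 1 <= 4.

Lemma e_gt0 x : 0 < e x.
Proof.
have e0 : 1 <= e 0 by have := e_ge1D 0; rewrite addr0.
rewrite lt0r; apply/andP; split.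
  apply/eqP => ex0; move: e0; rewrite -(subrr x) eD ex0 mul0r; lra.
by rewrite -[x](subrK (x / 2)) (_ : x - x / 2 = x / 2) ?eD ?sqr_ge0 //; field.
Qed.

Lemma e_mono x y : x <= y -> e x <= e y.
Proof.
move=> xy; have E1 : 1 <= e (y - x).
  by apply: le_trans (e_ge1D _); rewrite lerDl subr_ge0.
by rewrite -[leRHS](congr1 e (subrKC x y)) eD ler_peMr // ltW // e_gt0.
Qed.

Lemma e_nat (k : nat) : e k%:R <= (4 ^ k)%:R.
Proof.
elim: k => [|k IHk].
  have := eD 0 0; have := e_gt0 0; rewrite addr0 expn0 mulr0n mulr1n.
  by move: (e 0) => x; nra.
rewrite -natr1 eD expnS natrM mulrC; apply: ler_pM => //; exact/ltW/e_gt0.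
Qed.

Definition inv_sqrt (j : nat) : R := (Num.sqrt j%:R)^-1.

Lemma inv_sqrt_ge0 j : 0 <= inv_sqrt j.
Proof. by rewrite invr_ge0 sqrtr_ge0. Qed.

Lemma inv_sqrtM : {morph inv_sqrt : i j / (i * j)%N >-> i * j}.
Proof. by move=> i j; rewrite /inv_sqrt natrM sqrtrM // invfM. Qed.

Lemma inv_sqrt_sq j : (0 < j)%N -> inv_sqrt j * inv_sqrt j * j%:R = 1.
Proof.
move=> j_gt0; have j0 : (0 : R) < j%:R by rewrite ltr0n.
rewrite -invfM -expr2 sqr_sqrtr ?mulVf ?ltW //; exact: lt0r_neq0.
Qed.

Lemma inv_sqrt_prime p : prime p -> inv_sqrt p <= 3 / 4.
Proof.
move=> /prime_gt1 p2; have := inv_sqrt_sq (ltnW p2); have := inv_sqrt_ge0 p.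
have : (2 : R) <= p%:R by rewrite ler_nat.
by move: (inv_sqrt p) (p%:R : R) => x y; nra.
Qed.

Lemma sum_inv_sqrt_sorted (s : seq nat) : sorted ltn s -> all (leq 1) s ->
  \sum_(p <- s) inv_sqrt p <= 2 * Num.sqrt (size s)%:R.
Proof.
(* The bound on the last entry is what makes induction from the right work: a new entry [x] is at
   least the new length. *)
suff: sorted ltn s -> all (leq 1) s -> (size s <= last 0 s)%N /\
  \sum_(p <- s) inv_sqrt p <= 2 * Num.sqrt (size s)%:R.
  by move=> h h1 h2; case: (h h1 h2).
elim/last_ind: s => [|s x IHs].
  by rewrite big_nil sqrtr0 mulr0.
rewrite all_rcons => sx /andP[x0 s0].
have ss : sorted ltn s by move: sx; case: (s) => //= a t; rewrite rcons_path => /andP[].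
have [sl sums] := IHs ss s0.
have xl : (size s < x)%N.
  case: (s) sx sl => [|a t] //=; rewrite rcons_path => /andP[_] /=; lia.
rewrite last_rcons size_rcons; split => //.
rewrite big_rcons /=.
(* Telescoping: with [v^2 = u^2 + 1] and [u <= v], one has [2 (v - u) = 2 / (v + u) >= 1 / v], and
   [v^2 <= x]. *)
have : inv_sqrt x <= 2 * Num.sqrt (size s).+1%:R - 2 * Num.sqrt (size s)%:R.
  have u0 := sqrtr_ge0 ((size s)%:R : R); have v0 := sqrtr_ge0 ((size s).+1%:R : R).
  have uu : Num.sqrt ((size s)%:R : R) ^+ 2 = (size s)%:R by rewrite sqr_sqrtr.
  have vv : Num.sqrt ((size s).+1%:R : R) ^+ 2 = (size s)%:R + 1.
    by rewrite sqr_sqrtr // natr1.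
  have uv : Num.sqrt ((size s)%:R : R) <= Num.sqrt ((size s).+1%:R : R).
    by rewrite ler_wsqrtr // ler_nat.
  have xE := inv_sqrt_sq x0; have ix0 := inv_sqrt_ge0 x.
  have xl' : (size s)%:R + 1 <= x%:R :> R by rewrite natr1 ler_nat.
  move: u0 v0 uu vv uv xE ix0 xl'.
  move: (Num.sqrt (size s).+1%:R) (Num.sqrt (size s)%:R) (inv_sqrt x) => v u w.
  move: (x%:R : R) ((size s)%:R : R) => z c u0 v0 uu vv uv xE ix0 xl'.
  have wv : w * v <= 1.
    by rewrite leNgt; apply/negP => lt1; have : 1 < (w * v) ^+ 2; nra.
  have v_gt0 : 0 < v by nra.
  rewrite -(ler_pM2r v_gt0); nra.
lra.
Qed.

(** Enlarge the divisors to all [j <= n] whose primes divide [n]. The Euler product is at most [e]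
    of 4 times the sum of [p^(-1/2)] over [p | n]. That sum is at most [2 sqrt(omega(n)) <= 2 s],
    and [e (8 s) <= 4^(8 s)]. *)
Lemma sum_inv_sqrt_divisors n s : (0 < n)%N -> (trunc_log 2 n <= s ^ 2)%N ->
  \sum_(d <- divisors n) inv_sqrt d <= (2 ^ (16 * s))%:R.
Proof.
move=> n_gt0 ns.
have primesP p : p \in primes n -> prime p by rewrite mem_primes => /and3P[].
have W_le : \sum_(d <- divisors n) inv_sqrt d <=
    \sum_(j <- iota 1 n | all (mem (primes n)) (primes j)) inv_sqrt j.
  rewrite -[leRHS]big_filter; apply: ler_sum_sub => //.
  - exact: divisors_uniq.
  - exact/filter_uniq/iota_uniq.
  - move=> d; rewrite -dvdn_divisors // => dn; rewrite mem_filter mem_iota.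
    apply/andP; split; last by rewrite (dvdn_gt0 n_gt0 dn) add1n ltnS dvdn_leq.
    apply/allP => p; rewrite /= !mem_primes n_gt0 => /and3P[-> _ pd] /=.
    exact: dvdn_trans dn.
  - exact: inv_sqrt_ge0.
have := @smooth_sum_le _ inv_sqrt inv_sqrt_ge0 inv_sqrtM (primes n) n.
rewrite {1}/inv_sqrt sqrtr1 invr1 => /(_ erefl) smooth.
set A := \sum_(j <- iota 1 n | _) _ in W_le smooth.
set pr := \prod_(p <- _) _ in smooth.
have A0 : 0 <= A by apply: sumr_ge0 => j _; apply: inv_sqrt_ge0.
have pr_exp : 1 <= pr * e (4 * \sum_(p <- primes n) inv_sqrt p).
  rewrite /pr; elim: (primes n) primesP => [|p t IHt] pt.
    by rewrite !big_nil mulr0 mul1r; have := e_ge1D 0; lra.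
  rewrite !big_cons mulrDr eD mulrACA -[leLHS]mulr1; apply: ler_pM => //; last first.
    by apply: IHt => q tq; apply: pt; rewrite inE tq orbT.
  have p34 := inv_sqrt_prime (pt p (mem_head _ _)); have p0 := inv_sqrt_ge0 p.
  (* For [0 <= x <= 3/4] one has [(1 - x)(1 + 4 x) = 1 + x (3 - 4 x) >= 1]. *)
  apply: (@le_trans _ _ ((1 - inv_sqrt p) * (1 + 4 * inv_sqrt p))).
    by move: (inv_sqrt p) p34 p0 => x; nra.
  by apply: ler_wpM2l (e_ge1D _); lra.
have exp_le : e (4 * \sum_(p <- primes n) inv_sqrt p) <= (2 ^ (16 * s))%:R.
  have -> : (2 ^ (16 * s) = 4 ^ (8 * s))%N by rewrite -[4%N]/(2 ^ 2)%N -expnM mulnA.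
  apply: le_trans (e_nat _); apply: e_mono.
  have h : \sum_(p <- primes n) inv_sqrt p <= 2 * Num.sqrt (size (primes n))%:R.
    apply: sum_inv_sqrt_sorted; first exact: sorted_primes.
    by apply/allP => p /primesP /prime_gt0.
  have : Num.sqrt (size (primes n))%:R <= s%:R :> R.
    rewrite -[leRHS](ger0_norm (ler0n R s)) -sqrtr_sqr -natrX ler_wsqrtr // ler_nat.
    exact: leq_trans (size_primes_le_log n_gt0) ns.
  by rewrite natrM; lra.
have Apr : A * pr <= 1.
  rewrite mulrC; apply: smooth => p /primesP pr_p; split=> //.
  by have := inv_sqrt_prime pr_p; lra.
apply: le_trans W_le _; apply: le_trans exp_le.
have e0 := e_gt0 (4 * \sum_(p <- primes n) inv_sqrt p).
move: (e _) pr_exp e0 Apr A0 => x; clearbody A pr => x1 x0 Apr A0.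
have : A <= A * (pr * x) by rewrite ler_peMr.
have : A * pr * x <= 1 * x by rewrite ler_wpM2r // ltW.
by rewrite mul1r -mulrA => h1 h2; apply: le_trans h1.
Qed.

(** Each counted [m] has [1 <= sqrt(Z / (l m))], so the count is at most [sqrt(Z / l)] times the sum
    of [m^(-1/2)]. Squaring gives a statement about integers. *)
Lemma rankin_count n s l Z : (0 < n)%N -> (trunc_log 2 n <= s ^ 2)%N ->
  (count (fun m => l * m <= Z) (divisors n) ^ 2 * l <= Z * 2 ^ (32 * s))%N.
Proof.
move=> n_gt0 ns; set c := count _ _.
have W_le := sum_inv_sqrt_divisors n_gt0 ns.
have sum_c : c%:R * Num.sqrt l%:R <= Num.sqrt Z%:R * (2 ^ (16 * s))%:R :> R.
  apply: le_trans (ler_wpM2l (sqrtr_ge0 _) W_le).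
  rewrite /c -sum1_count natr_sum mulr_suml mulr_sumr big_mkcond /=.
  rewrite big_seq [leRHS]big_seq; apply: ler_sum => m.
  rewrite -dvdn_divisors // => mn; have m_gt0 := dvdn_gt0 n_gt0 mn.
  have rhs0 : 0 <= Num.sqrt Z%:R * inv_sqrt m by rewrite mulr_ge0 ?sqrtr_ge0 ?inv_sqrt_ge0.
  case: ifP => // lmZ; rewrite mul1r ler_pdivlMr ?sqrtr_gt0 ?ltr0n //.
  by rewrite -sqrtrM ?ler0n // -natrM ler_wsqrtr // ler_nat.
have -> : (2 ^ (32 * s))%N = ((2 ^ (16 * s)) ^ 2)%N by rewrite -expnM mulnAC.
rewrite -(ler_nat R); move: (2 ^ (16 * s))%N sum_c => t sum_c.
rewrite (natrM _ (c ^ 2)) (natrM _ Z) !natrX.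
have -> : (l%:R : R) = Num.sqrt l%:R ^+ 2 by rewrite sqr_sqrtr.
have -> : (Z%:R : R) = Num.sqrt Z%:R ^+ 2 by rewrite sqr_sqrtr.
by rewrite -!exprMn ler_pXn2r ?nnegrE ?mulr_ge0 ?sqrtr_ge0 ?ler0n.
Qed.

(** With [t = 2^(16 s)], every [d >= t^2] satisfies [1 / d <= d^(-1/2) / t], and the sum of
    [d^(-1/2)] is at most [t]. *)
Lemma rankin_tail n s : (0 < n)%N -> (trunc_log 2 n <= s ^ 2)%N ->
  (\sum_(d <- divisors n | 2 ^ (32 * s) <= d) n %/ d <= n)%N.
Proof.
move=> n_gt0 ns; have W_le := sum_inv_sqrt_divisors n_gt0 ns.
rewrite -(ler_nat R) natr_sum.
have t0 : 0 < (2 ^ (16 * s))%:R :> R by rewrite ltr0n expn_gt0.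
have tE : (2 ^ (32 * s))%:R = (2 ^ (16 * s))%:R ^+ 2 :> R.
  by rewrite -natrX -expnM mulnAC.
move: (2 ^ (16 * s))%:R W_le t0 tE => t W_le t0 tE.
apply: (@le_trans _ _ (n%:R / t * \sum_(d <- divisors n) inv_sqrt d)); last first.
  by rewrite mulrAC ler_pdivrMr // ler_wpM2l.
rewrite mulr_sumr big_mkcond /= big_seq [leRHS]big_seq; apply: ler_sum => d.
rewrite -dvdn_divisors // => dn; have d_gt0 := dvdn_gt0 n_gt0 dn.
have w0 := inv_sqrt_ge0 d; have wd := inv_sqrt_sq d_gt0.
case: ifP => [|_]; last first.
  by apply: mulr_ge0 => //; apply: divr_ge0; rewrite ?ler0n ?ltW.
rewrite -(ler_nat R) tE => td.
have -> : (n %/ d)%:R = n%:R * (inv_sqrt d * inv_sqrt d) :> R.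
  by rewrite -{2}(divnK dn) natrM -mulrA [d%:R * _]mulrC wd mulr1.
rewrite -mulrA ler_wpM2l // ler_wpM2r // -[leRHS]mul1r ler_pdivlMr //.
by move: (inv_sqrt d) (d%:R : R) w0 wd td => w D w0 wd td; nra.
Qed.

End Rankin.

(** * Covering by classes *)

Lemma Rexp_ge1D x : (1 + x <= exp x)%R.
Proof. exact/RleP/exp_ineq1_le. Qed.

Lemma Rexp1_le : (exp 1 <= 4%:R)%R.
Proof.
rewrite -INRE; apply/RleP; rewrite INR_IZR_INZ.
by apply: Rle_trans exp_le_3 _; apply: IZR_le.
Qed.

Lemma count_small_divisors n s l Z : 0 < n -> trunc_log 2 n <= s ^ 2 ->
  count (fun m => l * m <= Z) (divisors n) ^ 2 * l <= Z * 2 ^ (32 * s).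
Proof. exact: (rankin_count Rexp_ge1D exp_plus Rexp1_le). Qed.

Lemma sum_large_divisors n s : 0 < n -> trunc_log 2 n <= s ^ 2 ->
  \sum_(d <- divisors n | 2 ^ (32 * s) <= d) n %/ d <= n.
Proof. exact: (rankin_tail Rexp_ge1D exp_plus Rexp1_le). Qed.

Section Covering.

Variables n l : nat.
Hypotheses (n_gt0 : 0 < n) (l_gt0 : 0 < l).

Notation K := (@gcd_class n).
Notation L := (trunc_log 2 n).

(** The cost of [B] is measured by [l * #|B|], so that the target [n log n / l] becomes an integer
    bound without division. *)
Definition coverable (X : {set 'I_n}) (w : nat) : Prop :=
  exists B : {set 'I_n}, l * #|B| <= w /\
    forall x, x \in X -> exists2 b, b \in B & covers l b x.

Lemma coverable_leq X w w' : w <= w' -> coverable X w -> coverable X w'.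
Proof. by move=> ww [B [Bw BX]]; exists B; split=> //; apply: leq_trans ww. Qed.

Lemma coverable0 w : coverable set0 w.
Proof. by exists set0; rewrite cards0 muln0; split=> // x; rewrite inE. Qed.

Lemma coverableU X Y w w' : coverable X w -> coverable Y w' ->
  coverable (X :|: Y) (w + w').
Proof.
move=> [B [Bw BX]] [B' [Bw' BX']]; exists (B :|: B'); split.
  apply: leq_trans (leq_add Bw Bw'); rewrite -mulnDr leq_mul2l.
  by rewrite (leq_card_setU B B') orbT.
move=> x; rewrite inE => /orP[/BX|/BX'] [b bB bx]; exists b => //; rewrite inE bB ?orbT //.
Qed.

Lemma coverable_bigcup (s : seq nat) (X : nat -> {set 'I_n}) w :
  {in s, forall d, coverable (X d) (w d)} ->
  coverable (\bigcup_(d <- s) X d) (\sum_(d <- s) w d).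
Proof.
elim: s => [|d s IHs] sX; first by rewrite !big_nil; apply: coverable0.
rewrite !big_cons; apply: coverableU; first exact/sX/mem_head.
by apply: IHs => e se; apply: sX; rewrite inE se orbT.
Qed.

(** The single element [d] suffices: the class consists of some [y d] with [y < m <= l]. *)
Lemma coverable_single d m : n = d * m -> m <= l -> coverable (K d) l.
Proof.
move=> nE ml; exists [set ordmod n_gt0 d]; rewrite cards1 muln1; split=> // x.
move=> /(gcd_classP n_gt0 _ nE)[y xE _]; exists (ordmod n_gt0 d); first exact: set11.
have d_gt0 : 0 < d by move: n_gt0; rewrite nE muln_gt0 => /andP[].
have ym : y < m by have := ltn_ord x; rewrite xE [X in _ < X]nE ltn_pmul2l.
apply: (@coversP _ _ _ _ y); first exact: leq_trans (ltnW ym) ml.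
by rewrite /= modnMmr mulnC -xE modn_small.
Qed.

Lemma coverable_greedy (bs X : {set 'I_n}) r k : 0 < #|bs| ->
  (forall x, x \in X -> #|bs| <= r * #|[set b in bs | covers l b x]|) ->
  coverable X (l * (r * k + #|X| %/ 2 ^ k)).
Proof.
move=> bs_gt0 bsX; have [->|[x0 Xx0]] := set_0Vmem X; first exact: coverable0.
have r_gt0 : 0 < r by case: (r) (bsX _ Xx0); rewrite // mul0n leqNgt bs_gt0.
(* The quotient of [#|bs|] by [r], rounded up. *)
pose D := (#|bs|.-1 %/ r).+1.
have bsD : #|bs| <= r * D by rewrite mulnC; have := ltn_ceil #|bs|.-1 r_gt0; rewrite -/D; lia.
have [|S [Srk SX]] := @greedy_cover _ _ (covers l) bs X r D k isT bsD.
  by move=> x /bsX; rewrite /D ltn_divLR // prednK // mulnC.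
by exists S; rewrite leq_pmul2l.
Qed.

(** The class covers itself: this is [card_covers_ge] with [e = d] and [f = 1], where the two class
    sizes cancel. *)
Lemma coverable_class d m r k : n = d * m -> l <= m ->
  #|K d| <= r * size (coprimes_upto m l) ->
  coverable (K d) (l * (r * k + #|K d| %/ 2 ^ k)).
Proof.
move=> nE lm Kr; have [->|[x0 Kx0]] := set_0Vmem (K d); first exact: coverable0.
have K_gt0 : 0 < #|K d| by apply/card_gt0P; exists x0.
apply: (coverable_greedy k K_gt0) => x Kx; apply: (leq_trans Kr).
rewrite leq_mul2l; apply/orP; right.
have nE1 : n = d * 1 * m by rewrite muln1.
have := @card_covers_ge _ n_gt0 l d 1 m l x nE1 _ lm.
rewrite mul1n muln1 leq_pmul2l // => -> //.
Qed.

Lemma covering_of_coverable (X : {set 'I_n}) w : (forall x, x \in X) -> coverable X w ->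
  exists B : {set 'I_n}, covering_set l B /\ l * #|B| <= w.
Proof.
move=> XT [B [Bw BX]]; exists B; split=> // x.
have [b bB /existsP[a /eqP ax]] := BX x (XT x).
by exists a, b; [rewrite -ltnS|split].
Qed.

Lemma mem_divisors_class (x : 'I_n) : x \in \bigcup_(d <- divisors n) K d.
Proof.
have : gcdn x n \in divisors n by rewrite -dvdn_divisors // dvdn_gcdr.
move=> h; rewrite (big_rem _ h) /= inE; apply/orP; left; rewrite inE //.
Qed.

Lemma count_codivisors (P : pred nat) :
  count (fun d => P (n %/ d)) (divisors n) <= count P (divisors n).
Proof.
rewrite -!size_filter -(size_map (fun d => n %/ d)); apply: uniq_leq_size.
  rewrite map_inj_in_uniq ?filter_uniq ?divisors_uniq // => d d'.
  rewrite !mem_filter -!dvdn_divisors // => /andP[_ dn] /andP[_ d'n] eq_nd.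
  have inv e : e %| n -> n %/ (n %/ e) = e by move=> en; rewrite divnA // mulKn.
  by rewrite -(inv d dn) eq_nd inv.
move=> m /mapP[d]; rewrite !mem_filter -!dvdn_divisors // => /andP[Pd dn] ->.
by rewrite Pd /=; apply/dvdnP; exists d; rewrite mulnC divnK.
Qed.

(* The cost of covering [K_d] by itself is proportional to [|K_d|], and the classes partition [Z_n]. *)
Lemma covering_small c : 0 < size (coprimes_upto n l) ->
  l * (trunc_log 2 l).+1 <= c * size (coprimes_upto n l) ->
  exists B : {set 'I_n}, covering_set l B /\ l * #|B| <= l * l + (2 * c + 1) * n.
Proof.
set D := size _; set k := trunc_log 2 l => D_gt0 lkD.
(* Classes with [n %/ d <= l] cost [l] each and number at most [l]; the others pay in proportion to
   their size. *)
pose w d := l * (n %/ d <= l) + (2 * c + 1) * #|K d|.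
have cov_d : {in divisors n, forall d, coverable (K d) (w d)}.
  move=> d; rewrite -dvdn_divisors // => dn; set m := n %/ d.
  have nE : n = d * m by rewrite mulnC divnK.
  rewrite /w -/m; case: (leqP m l) => [ml|lm].
    by apply: coverable_leq (coverable_single nE ml); rewrite muln1 leq_addr.
  rewrite muln0 add0n.
  have [->|[x0 Kx0]] := set_0Vmem (K d); first exact: coverable0.
  have DS : D <= size (coprimes_upto m l).
    apply: uniq_leq_size; first exact: uniq_coprimes_upto.
    move=> a; rewrite !mem_coprimes_upto => /and3P[-> ->].
    by rewrite nE coprimeMr => /andP[].
  have SK : size (coprimes_upto m l) <= #|K d|.
    have nE1 : n = d * 1 * m by rewrite muln1.
    have := @card_covered_ge _ n_gt0 l d 1 m l x0 nE1 _ (ltnW lm) Kx0.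
    rewrite mul1n muln1 => /(_ (leqnn _)) h; apply: leq_trans h _.
    by apply/subset_leq_card/subsetP => x; rewrite inE => /andP[].
  (* Since [D <= #|K d|], rounding up at most doubles the quotient. *)
  pose r := (#|K d| %/ D).+1.
  have KrD : #|K d| <= r * D by rewrite ltnW // ltn_ceil.
  have KrS : #|K d| <= r * size (coprimes_upto m l).
    by apply: leq_trans KrD _; rewrite leq_mul2l DS orbT.
  apply: coverable_leq (coverable_class k.+1 nE (ltnW lm) KrS).
  have rD : r * D <= 2 * #|K d|.
    by rewrite /r mulSn; have := leq_trunc_div #|K d| D; have := leq_trans DS SK; lia.
  have h1 : l * (r * k.+1) <= c * (2 * #|K d|).
    apply: (@leq_trans (c * (r * D))); last by rewrite leq_mul2l rD orbT.
    have -> : l * (r * k.+1) = r * (l * k.+1) by lia.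
    have -> : c * (r * D) = r * (c * D) by lia.
    by rewrite leq_mul2l lkD orbT.
  (* As [2^k.+1 > l], about [log l] halvings suffice: the leftover points cost no more than the
     class size. *)
  have h2 : l * (#|K d| %/ 2 ^ k.+1) <= #|K d|.
    apply: leq_trans (leq_trunc_div #|K d| (2 ^ k.+1)).
    by rewrite mulnC leq_mul2l ltnW ?orbT // trunc_log_ltn.
  by rewrite mulnDr; lia.
have [B [covB Bw]] := covering_of_coverable mem_divisors_class (coverable_bigcup cov_d).
exists B; split=> //; apply: leq_trans Bw _.
rewrite /w big_split /= -!big_distrr /=; apply: leq_add; last first.
  by rewrite leq_mul2l sum_card_gcd_class ?orbT // divisors_uniq.
rewrite leq_mul2l; apply/orP; right.
rewrite -big_mkcond sum1_count; apply: leq_trans (count_codivisors (leq^~ l)) _.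
rewrite -size_filter -[X in _ <= X](size_iota 1); apply: uniq_leq_size.
  exact/filter_uniq/divisors_uniq.
move=> m; rewrite mem_filter mem_iota -dvdn_divisors // => /andP[ml mn].
by rewrite (dvdn_gt0 n_gt0 mn) add1n ltnS.
Qed.

End Covering.

(** An integer substitute for [sqrt L]. *)
Lemma sqrt_sandwich L : exists s, L <= s ^ 2 <= 4 * L.
Proof.
elim: L => [|L [s /andP[Ls sL]]]; first by exists 0.
have [Ls'|sL'] := leqP L.+1 (s ^ 2); first by exists s; rewrite Ls' /=; lia.
exists s.+1; move: Ls sL sL'; rewrite !expnS !expn0 !muln1; nia.
Qed.

Lemma leq_mul24_exp2 h : 8 <= h -> 24 * h.+1 <= 2 ^ h.
Proof.
move=> h8; rewrite -(subnK h8); elim: (h - 8) => [|i IHi] //.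
by rewrite addSn expnS; lia.
Qed.

(** Only primes are counted. Of those up to [l], at most [w], about [sqrt l], are small, and at most
    [log n / h] larger ones divide [n]. Each loss is at most [l / (12 k.+1)], together half of
    Chebyshev's bound [l / (3 k.+1)]. *)
Lemma coprime_count_chebyshev n l : 0 < n -> 2 ^ 17 * trunc_log 2 n < l -> 1 < n ->
  l <= 6 * (trunc_log 2 l).+1 * size (coprimes_upto n l).
Proof.
move=> n_gt0 Ll n_gt1; set k := trunc_log 2 l; pose h := k %/ 2; pose w := 2 ^ h.
have L_gt0 : 0 < trunc_log 2 n by rewrite trunc_log_gt0.
have l17 : 2 ^ 17 <= l by apply: ltnW; apply: leq_ltn_trans Ll; rewrite leq_pmulr.
have l_gt1 : 1 < l by apply: leq_trans l17; rewrite -{1}(expn1 2) leq_exp2l.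
have k17 : 17 <= k by apply: trunc_log_max.
have {l17} h8 : 8 <= h by rewrite /h; lia.
have kh : k.+1 <= 2 * h.+1 by rewrite /h; lia.
have w2l : w * w <= l.
  apply: leq_trans (trunc_logP (ltnSn 1) (ltnW l_gt1)).
  by rewrite -expnD leq_exp2l // -/k /h; lia.
have hw : 24 * h.+1 <= w by apply: leq_mul24_exp2.
have cheb := chebyshev_lower l_gt1; rewrite -/k in cheb.
have avoid := size_primes_avoid l w n_gt0.
set P := [seq q <- _ | _] in avoid; set Q := [seq p <- _ | _] in avoid.
have PD : size P <= size (coprimes_upto n l).
  apply: uniq_leq_size; first exact/filter_uniq/uniq_primes_upto.
  move=> q; rewrite mem_filter mem_primes_upto mem_coprimes_upto.
  by move=> /andP[/andP[_ qn] /andP[pr_q ->]]; rewrite prime_gt0 //= prime_coprime.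
have QL : h * size Q <= trunc_log 2 n.
  apply: trunc_log_max => //; rewrite expnM.
  apply: (@leq_trans (\prod_(p <- Q) p ^ logn p n)).
    apply: expn_leq_prod => p; rewrite mem_filter => /andP[wp pn].
    apply: leq_trans (ltnW wp) _; rewrite -{1}(expn1 p) leq_pexp2l ?logn_gt0 //.
    by move: pn; rewrite mem_primes => /and3P[/prime_gt0].
  rewrite [leqRHS](prod_primes_logn n_gt0) /Q big_filter [leqRHS](bigID (fun p => w < p)) /=.
  apply: leq_pmulr; rewrite big_seq_cond; apply: prodn_cond_gt0 => p /andP[pn _].
  by rewrite expn_gt0; move: pn; rewrite mem_primes => /and3P[/prime_gt0->].
have Q_le : 12 * (k.+1 * size Q) <= l.
  apply: ltnW; apply: leq_ltn_trans Ll.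
  apply: (@leq_trans (48 * (h * size Q))).
    have -> : 48 * (h * size Q) = (48 * h) * size Q by lia.
    by rewrite mulnA leq_mul2r; apply/orP; right; lia.
  by apply: leq_mul => //; rewrite -[48]/(48 ^ 1) (@leq_trans (2 ^ 6)) ?leq_exp2l.
have w_le : 12 * (k.+1 * w) <= l.
  apply: leq_trans w2l; rewrite mulnA leq_mul2r; apply/orP; right; lia.
have : k.+1 * size (primes_upto l) <= k.+1 * (size (coprimes_upto n l) + w + size Q).
  by rewrite leq_mul2l; apply/orP; right; lia.
lia.
Qed.

(** The bound of [sieve_lower] with a symbolic exponent in place of 48; the later constants are
    formulas in [h]. *)
Definition sieve_from (h : nat) : Prop := forall m y, 0 < m -> 2 ^ h <= y ->
  size (primes m) ^ 2 <= y -> y * totient m <= 96 * m * size (coprimes_upto m y).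

(** * Large [l]: units for the good divisors, class by class for the bad ones *)

Section Large.

Variables h n l s : nat.
Hypothesis sieve : sieve_from h.
Hypotheses (n_gt1 : 1 < n) (ln : l < n) (l_gt0 : 0 < l).
Hypothesis sL : trunc_log 2 n <= s ^ 2.
Hypothesis sl : 2 ^ ((h + 37) * s) <= l.

Let n_gt0 : 0 < n := ltnW n_gt1.
Notation K := (@gcd_class n).
Notation L := (trunc_log 2 n).

Let s_gt0 : 0 < s.
Proof.
have : 0 < L by rewrite trunc_log_gt0.
by move: sL; case: s => //; rewrite exp0n //; lia.
Qed.

(** A length from which the sieve applies modulo [m]; the second term dominates [omega(m)^2]. *)
Let threshold m := 2 ^ h + trunc_log 2 m ^ 2.

Let threshold_le m : 0 < m -> m <= n -> threshold m <= 2 ^ ((h + 5) * s).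
Proof.
move=> m_gt0 mn; have tL : trunc_log 2 m <= s ^ 2.
  exact: leq_trans (leq_trunc_log 2 mn) sL.
have h1 : 2 ^ h <= 2 ^ (h * s) by rewrite leq_exp2l // leq_pmulr.
have h2 : trunc_log 2 m ^ 2 <= 2 ^ (4 * s).
  apply: (@leq_trans ((s ^ 2) ^ 2)); first by rewrite leq_exp2r.
  by rewrite -expnM -[2 * 2]/4 [4 * s]mulnC expnM leq_exp2r // ltnW // ltn_expl.
have -> : (h + 5) * s = h * s + 4 * s + s by lia.
rewrite (expnD 2 (h * s + 4 * s)) (expnD 2 (h * s)).
have a1 : 0 < 2 ^ (h * s) by rewrite expn_gt0.
have a2 : 0 < 2 ^ (4 * s) by rewrite expn_gt0.
have a3 : 2 <= 2 ^ s by rewrite -{1}(expn1 2) leq_exp2l.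
apply: (leq_trans (leq_add h1 h2)).
move: (2 ^ (h * s)) (2 ^ (4 * s)) (2 ^ s) a1 a2 a3 => x y z x0 y0 z2.
apply: (@leq_trans (x * y * 2)); last by rewrite leq_mul2l z2 orbT.
nia.
Qed.

Let good d := threshold (n %/ d) <= l %/ d.

Let sieve_threshold m y : 0 < m -> threshold m <= y ->
  y * totient m <= 96 * m * size (coprimes_upto m y).
Proof.
move=> m_gt0 ty; apply: sieve => //; first by apply: leq_trans ty; rewrite leq_addr.
apply: leq_trans ty; apply: leq_trans (leq_addl _ _).
by rewrite leq_exp2r // size_primes_le_log.
Qed.

(** Let [x] have gcd [d], [m = n %/ d], [y = l %/ d]. The proportion of units covering [x] is at
    least the coprime count up to [y] over [#|K d|]. As [#|K d| <= totient m], the totient cancels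
    and leaves [y / (96 m) >= l / (192 n)], uniformly in [d]. *)
Lemma coverable_good :
  coverable l [set x : 'I_n | good (gcdn x n)] (193 * n * L.+1).
Proof.
set X := [set x | _]; pose r := (192 * n %/ l).+1.
have K1 : 0 < #|K 1|.
  apply/card_gt0P; exists (Ordinal n_gt1); rewrite inE /= gcd1n //.
have bsX x : x \in X -> #|K 1| <= r * #|[set b in K 1 | covers l b x]|.
  rewrite inE; set d := gcdn x n => good_d.
  have dn : d %| n by rewrite dvdn_gcdr.
  have d_gt0 := dvdn_gt0 n_gt0 dn.
  pose m := n %/ d; pose y := l %/ d.
  have nE : n = d * m by rewrite mulnC divnK.
  have m_gt0 : 0 < m by rewrite divn_gt0 // dvdn_leq.
  have Kx : x \in K d by rewrite inE.
  have nE1 : n = 1 * d * m by rewrite mul1n.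
  have dy : d * y <= l by rewrite mulnC leq_trunc_div.
  have ym : y <= m by apply: leq_div2r; apply: ltnW.
  have := @card_covers_ge _ n_gt0 l 1 d m y x nE1 dy ym; rewrite mul1n => /(_ Kx).
  set S := size _; set C := #|[set b in _ | _]| => KC.
  have yphi : y * totient m <= 96 * m * S by apply: sieve_threshold.
  have Kphi := card_gcd_class_totient n_gt0 nE.
  have Kd_gt0 : 0 < #|K d| by apply/card_gt0P; exists x.
  have y_gt0 : 0 < y by apply: leq_trans good_d; rewrite addn_gt0 expn_gt0.
  have ly : l <= 2 * (d * y) by have := ltn_ceil l d_gt0; rewrite -/y; nia.
  have step1 : #|K 1| * y <= 96 * m * C.
    rewrite -(leq_pmul2r Kd_gt0).
    apply: (@leq_trans (#|K 1| * (96 * m * S))).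
      rewrite -mulnA leq_mul2l; apply/orP; right; apply: leq_trans yphi.
      by rewrite leq_mul2l Kphi orbT.
    have -> : #|K 1| * (96 * m * S) = 96 * m * (#|K 1| * S) by lia.
    by rewrite -[leqRHS]mulnA (mulnC C) leq_mul2l KC orbT.
  have step2 : #|K 1| * l <= 192 * n * C.
    apply: (@leq_trans (#|K 1| * (2 * (d * y)))); first by rewrite leq_mul2l ly orbT.
    have -> : #|K 1| * (2 * (d * y)) = 2 * d * (#|K 1| * y) by lia.
    have -> : 192 * n * C = 2 * d * (96 * m * C) by rewrite nE; lia.
    by rewrite leq_mul2l step1 orbT.
  rewrite -(leq_pmul2r l_gt0); apply: (leq_trans step2).
  have -> : r * C * l = r * l * C by lia.
  by rewrite leq_mul2r ltnW ?orbT // ltn_ceil.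
apply: coverable_leq (coverable_greedy n_gt0 l_gt0 L.+1 K1 bsX).
(* After [L.+1] halvings nothing remains, because [2^L.+1 > n]. *)
rewrite [#|X| %/ _]divn_small ?addn0; last first.
  apply: leq_ltn_trans (trunc_log_ltn n (ltnSn 1)).
  by rewrite -[leqRHS]card_ord max_card.
have : l * r <= 193 * n.
  by rewrite /r mulnS mulnC; have := leq_trunc_div (192 * n) l; lia.
by rewrite mulnA => lr; rewrite leq_mul2r lr orbT.
Qed.

Lemma coverable_bad d : d %| n -> coverable l (K d) (l + 97 * L.+1 * (n %/ d)).
Proof.
move=> dn; have d_gt0 := dvdn_gt0 n_gt0 dn; set m := n %/ d.
have nE : n = d * m by rewrite mulnC divnK.
have m_gt0 : 0 < m by rewrite divn_gt0 // dvdn_leq.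
case: (leqP m l) => [ml|lm].
  by apply: coverable_leq (coverable_single n_gt0 nE ml); rewrite leq_addr.
have tl : threshold m <= l.
  apply: leq_trans (threshold_le m_gt0 _) _; first exact: leq_div.
  by apply: leq_trans sl; rewrite leq_exp2l // leq_mul2r; apply/orP; right; lia.
have phi := sieve_threshold m_gt0 tl; have Kphi := card_gcd_class_totient n_gt0 nE.
pose r := (96 * m %/ l).+1.
have Kr : #|K d| <= r * size (coprimes_upto m l).
  rewrite -(leq_pmul2l l_gt0); apply: (@leq_trans (l * totient m)).
    by rewrite leq_mul2l Kphi orbT.
  apply: leq_trans phi _; rewrite mulnA leq_mul2r; apply/orP; right.
  by rewrite [l * r]mulnC ltnW // ltn_ceil.
apply: coverable_leq (coverable_class n_gt0 l_gt0 L.+1 nE (ltnW lm) Kr).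
rewrite [_ %/ 2 ^ _]divn_small ?addn0; last first.
  apply: leq_ltn_trans (trunc_log_ltn n (ltnSn 1)).
  by rewrite -[leqRHS]card_ord max_card.
have lr : l * r <= 97 * m.
  by rewrite /r mulnS mulnC; have := leq_trunc_div (96 * m) l; lia.
apply: (@leq_trans (97 * m * L.+1)); last by lia.
by rewrite mulnA leq_mul2r lr orbT.
Qed.

(** Badness means [l < d * threshold (n %/ d)] with threshold at most [2^((h + 5) s)]; the 37 in the
    lower bound for [l] leaves exactly the cutoff [2^(32 s)] of the Rankin tail. *)
Lemma bad_divisor_large d : d %| n -> ~~ good d -> 2 ^ (32 * s) <= d.
Proof.
move=> dn; have d_gt0 := dvdn_gt0 n_gt0 dn.
have m_gt0 : 0 < n %/ d by rewrite divn_gt0 // dvdn_leq.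
rewrite -ltnNge ltn_divLR // => ld.
have := leq_ltn_trans sl ld.
have -> : (h + 37) * s = 32 * s + (h + 5) * s by lia.
rewrite expnD => lt; rewrite -(@leq_pmul2r (2 ^ ((h + 5) * s))) ?expn_gt0 //.
apply: ltnW; apply: leq_trans lt _; rewrite mulnC leq_mul2l threshold_le ?orbT //.
exact: leq_div.
Qed.

(** For codivisors [m = n %/ d], badness reads [l m < n * threshold m]. If [n < l 2^((h + 37) s)],
    then [log m = O(s)], the threshold is [O(L)], and [m] itself is [O(n L / l)]. Otherwise Rankin's
    count [c] has [c^2 l <= n 2^((h + 37) s)], whence [(l c)^2 <= n^2]. *)
Lemma count_bad_divisors : s ^ 2 <= 4 * L ->
  l * count (fun d => ~~ good d) (divisors n) <= (2 ^ h + 4 * (2 * h + 42) ^ 2) * (n * L).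
Proof.
move=> s4L; pose P m := l * m < n * threshold m.
have L_gt0 : 0 < L by rewrite trunc_log_gt0.
set C5 := 2 ^ h + _.
have C5_gt0 : 0 < C5 by rewrite addn_gt0 expn_gt0.
have bad_P : count (fun d => ~~ good d) (divisors n) <= count P (divisors n).
  apply: leq_trans (count_codivisors n_gt0 P).
  rewrite -!size_filter; apply: uniq_leq_size; first exact/filter_uniq/divisors_uniq.
  move=> d; rewrite !mem_filter => /andP[+ dn]; rewrite dn andbT.
  move: dn; rewrite -dvdn_divisors // => dn; have d_gt0 := dvdn_gt0 n_gt0 dn.
  rewrite -ltnNge ltn_divLR // /P => ld.
  have m_gt0 : 0 < n %/ d by rewrite divn_gt0 // dvdn_leq.
  have := ld; rewrite -(ltn_pmul2r m_gt0) -mulnA [d * _]mulnC divnK //.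
  by rewrite [_ * n]mulnC.
have P_le m : m \in divisors n -> P m -> 0 < m /\ l * m < n * 2 ^ ((h + 5) * s).
  rewrite -dvdn_divisors // => mn Pm; have m_gt0 := dvdn_gt0 n_gt0 mn; split=> //.
  apply: leq_trans Pm _; rewrite leq_mul2l threshold_le ?orbT //; exact: dvdn_leq.
apply: (@leq_trans (l * count P (divisors n))); first by rewrite leq_mul2l bad_P orbT.
have [nl|ln'] := ltnP n (l * 2 ^ ((h + 37) * s)).
  have count_le : count P (divisors n) <= C5 * (n * L) %/ l.
    rewrite -size_filter -[leqRHS](size_iota 1); apply: uniq_leq_size.
      exact/filter_uniq/divisors_uniq.
    move=> m; rewrite mem_filter => /andP[Pm mn]; have [m_gt0 lm] := P_le m mn Pm.
    rewrite mem_iota m_gt0 add1n ltnS leq_divRL //.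
    have m_lt : m < 2 ^ ((2 * h + 42) * s).
      rewrite -(ltn_pmul2l l_gt0); apply: leq_trans lm _.
      have -> : (2 * h + 42) * s = (h + 37) * s + (h + 5) * s by lia.
      by rewrite expnD mulnA leq_mul2r ltnW ?orbT.
    have tm : trunc_log 2 m <= (2 * h + 42) * s.
      rewrite -(leq_exp2l _ _ (ltnSn 1)); apply: leq_trans (ltnW m_lt).
      exact: trunc_logP.
    have th : threshold m <= C5 * L.
      rewrite mulnDl; apply: leq_add; first by rewrite leq_pmulr.
      apply: (@leq_trans (((2 * h + 42) * s) ^ 2)); first by rewrite leq_exp2r.
      by rewrite expnMn mulnC -mulnA [_ * L]mulnC mulnA leq_mul2r s4L orbT.
    rewrite mulnC; apply: ltnW; apply: leq_trans Pm _.
    by rewrite mulnCA leq_mul2l th orbT.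
  by rewrite mulnC; apply: leq_trans (leq_trunc_div _ l); rewrite leq_mul2r count_le orbT.
have cnt := count_small_divisors l (n * 2 ^ ((h + 5) * s)) n_gt0 sL.
have le_c : count P (divisors n) <=
    count (fun m => l * m <= n * 2 ^ ((h + 5) * s)) (divisors n).
  rewrite -!size_filter; apply: uniq_leq_size; first exact/filter_uniq/divisors_uniq.
  by move=> m; rewrite !mem_filter => /andP[Pm mn]; have [_ /ltnW->] := P_le m mn Pm.
set c := count _ _ in cnt le_c.
apply: (@leq_trans (l * c)); first by rewrite leq_mul2l le_c orbT.
apply: (@leq_trans n); last first.
  by rewrite -[n in n <= _]muln1 mulnCA leq_mul2l muln_gt0 C5_gt0 L_gt0 orbT.
rewrite -(@leq_exp2r _ _ 2) // expnMn [l ^ 2]expnS expn1 -mulnA [l * c ^ 2]mulnC.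
apply: (@leq_trans (l * (n * 2 ^ ((h + 5) * s) * 2 ^ (32 * s)))).
  by rewrite leq_mul2l cnt orbT.
rewrite -mulnA -expnD (_ : (h + 5) * s + 32 * s = (h + 37) * s); last by lia.
by rewrite mulnCA [n ^ 2]expnS expn1 leq_mul2l ln' orbT.
Qed.

(** The constant 580 is 386 for the good classes plus 194 for the terms [n %/ d] of the bad ones;
    the rest pays [l] per bad divisor. *)
Lemma covering_large : s ^ 2 <= 4 * L ->
  exists B : {set 'I_n}, covering_set l B /\
    l * #|B| <= (580 + (2 ^ h + 4 * (2 * h + 42) ^ 2)) * (n * L).
Proof.
move=> s4L; have L_gt0 : 0 < L by rewrite trunc_log_gt0.
pose bad := [seq d <- divisors n | ~~ good d].
have cov_bad : {in bad, forall d, coverable l (K d) (l + 97 * L.+1 * (n %/ d))}.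
  move=> d; rewrite mem_filter -dvdn_divisors // => /andP[_ dn]; exact: coverable_bad.
have cov := coverableU coverable_good (coverable_bigcup cov_bad).
have all_x x : x \in [set x : 'I_n | good (gcdn x n)] :|: \bigcup_(d <- bad) K d.
  rewrite in_setU in_set; have [//|bad_x] := boolP (good _).
  have h1 : gcdn x n \in bad.
    by rewrite mem_filter bad_x -dvdn_divisors // dvdn_gcdr.
  by rewrite (big_rem _ h1) /= !inE eqxx.
have [B [covB Bw]] := covering_of_coverable all_x cov.
exists B; split=> //; apply: leq_trans Bw _.
rewrite big_split /= -big_distrr /= big_const_seq count_predT iter_addn_0.
have cnt := count_bad_divisors s4L.
have sum_bad : \sum_(d <- bad) n %/ d <= n.
  apply: leq_trans (sum_large_divisors n_gt0 sL).
  rewrite big_filter big_mkcond [leqRHS]big_mkcond /=.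
  rewrite big_seq [leqRHS]big_seq; apply: leq_sum => d; rewrite -dvdn_divisors // => dn.
  by case: ifP => // bd; rewrite bad_divisor_large.
rewrite -size_filter -/bad in cnt.
set C5 := 2 ^ h + _ in cnt *.
have h2 : 97 * L.+1 * \sum_(d <- bad) n %/ d <= 194 * (n * L).
  apply: (@leq_trans (97 * L.+1 * n)); first by rewrite leq_mul2l sum_bad orbT.
  nia.
have h3 : 193 * n * L.+1 <= 386 * (n * L) by nia.
rewrite mulnDl; lia.
Qed.

End Large.

(** * The theorem *)

(** By [8 a s <= s^2 + 16 a^2], the exponent satisfies [2 a s <= log n + 4 a^2]. This absorbs the
    term [l * l] of [covering_small]. *)
Lemma sqr_le_of_log a s n l : 0 < l -> trunc_log 2 l < a * s ->
  s ^ 2 <= 4 * trunc_log 2 n -> 0 < n -> l * l <= 2 ^ (4 * a ^ 2) * n.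
Proof.
move=> l_gt0 ks s4L n_gt0; have lE := trunc_log_ltn l (ltnSn 1).
apply: (@leq_trans (2 ^ (a * s + a * s))).
  by rewrite expnD leq_mul // ltnW // (leq_trans lE) // leq_exp2l.
apply: (@leq_trans (2 ^ (4 * a ^ 2) * 2 ^ trunc_log 2 n)).
  rewrite -expnD leq_exp2l //; move: s4L; rewrite -!mulnn.
  have [+ _] := nat_Cauchy s (4 * a); rewrite -!mulnn; lia.
by rewrite leq_mul2l trunc_logP ?orbT.
Qed.

Lemma small_covering_set : exists C, forall n l, 1 < n -> 0 < l -> l < n ->
  exists B : {set 'I_n}, covering_set l B /\ l * #|B| <= C * (n * trunc_log 2 n).
Proof.
have [h sieve] : exists h, sieve_from h.
  by exists 48 => m y m_gt0; apply: sieve_lower.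
pose a := h + 37.
have [C0 C0E] : {C | C = 2 ^ 17} by exists (2 ^ 17).
pose C1 := 2 ^ (4 * a ^ 2) + (48 * a ^ 2 + 1).
pose C2 := 580 + (2 ^ h + 4 * (2 * h + 42) ^ 2).
exists (C0 + C1 + C2) => n l n_gt1 l_gt0 ln.
have n_gt0 : 0 < n by apply: ltnW.
have L_gt0 : 0 < trunc_log 2 n by rewrite trunc_log_gt0.
suff [C [CC [B [covB lB]]]] : exists C, C <= C0 + C1 + C2 /\ exists B : {set 'I_n},
    covering_set l B /\ l * #|B| <= C * (n * trunc_log 2 n).
  by exists B; split=> //; apply: leq_trans lB _; rewrite leq_mul2r CC orbT.
have [lC0|C0l] := leqP l (C0 * trunc_log 2 n).
  exists C0; split; first by rewrite -addnA leq_addr.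
  exists setT; split.
    by move=> x; exists 1, x; rewrite ?inE // mul1n modn_small.
  by rewrite cardsT card_ord [n * _]mulnC mulnA leq_mul2r lC0 orbT.
have [s /andP[Ls s4L]] := sqrt_sandwich (trunc_log 2 n).
have [ask|kas] := leqP (a * s) (trunc_log 2 l).
  exists C2; split; first by rewrite leq_addl.
  apply: (covering_large sieve n_gt1 ln l_gt0 Ls) => //.
  by apply: leq_trans (trunc_logP (ltnSn 1) l_gt0); rewrite leq_exp2l.
exists C1; split; first by rewrite addnAC leq_addl.
rewrite C0E in C0l; have cheb := coprime_count_chebyshev n_gt0 C0l n_gt1.
set D := size _ in cheb.
have D_gt0 : 0 < D by move: cheb; case: D => //; rewrite muln0 leqNgt l_gt0.
have lkD : l * (trunc_log 2 l).+1 <= 24 * a ^ 2 * trunc_log 2 n * D.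
  set k := trunc_log 2 l in kas cheb *.
  apply: (@leq_trans (6 * k.+1 * D * k.+1)); first by rewrite leq_mul2r cheb orbT.
  (* One factor [k.+1] comes from Chebyshev, one from the greedy halvings; in this range their
     product is [O(log n)]. *)
  have kk : k.+1 * k.+1 <= a ^ 2 * (4 * trunc_log 2 n).
    apply: (@leq_trans (a ^ 2 * s ^ 2)); last by rewrite leq_mul2l s4L orbT.
    by rewrite -expnMn [_ ^ 2]expnS expn1 leq_mul.
  have -> : 6 * k.+1 * D * k.+1 = 6 * (k.+1 * k.+1) * D by lia.
  rewrite leq_mul2r; apply/orP; right; lia.
have [B [covB lB]] := covering_small n_gt0 l_gt0 D_gt0 lkD.
exists B; split=> //; apply: leq_trans lB _.
have ll := sqr_le_of_log l_gt0 kas s4L n_gt0.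
rewrite /C1 [leqRHS]mulnDl; apply: leq_add.
  by apply: (leq_trans ll); rewrite leq_mul2l leq_pmulr ?orbT.
by move: (a ^ 2) (trunc_log 2 n) L_gt0 => b L L_gt0; nia.
Qed.

(* [%R] denotes [ring_scope] up to here, but the standard real numbers in the theorem. *)
Delimit Scope R_scope with R.

(** The factor 2 comes from [ln 2 > 1/2]. *)
Lemma trunc_log2_le_logm n : (0 < n)%N ->
  (INR (trunc_log 2 n) <= 2 * logm (INR n))%R.
Proof.
move=> n_gt0; have nR : (0 < INR n)%R by apply/lt_0_INR/ssrnat.ltP.
have le_ln : (INR (trunc_log 2 n) * ln 2 <= ln (INR n))%R.
  rewrite -ln_pow; last exact: Rlt_0_2.
  suff : (2 ^ trunc_log 2 n <= INR n)%R.
    case=> [lt|->]; last exact: Rle_refl.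
    by left; apply: ln_increasing lt; apply: pow_lt; exact: Rlt_0_2.
  have -> : (2 ^ trunc_log 2 n)%R = INR (expn 2 (trunc_log 2 n)).
    elim: (trunc_log 2 n) => [|k IHk] //.
    by rewrite expnS mult_INR -IHk /=; Lra.lra.
  by apply/le_INR/ssrnat.leP/trunc_logP.
have := Rmax_l (ln (INR n)) 1; rewrite -/(logm _) => le_logm.
have := pos_INR (trunc_log 2 n); have := ln_lt_2; Lra.nra.
Qed.

Theorem mainTheorem11 :
  exists C : R, (0 < C)%R /\
    forall n l : nat, (2 <= n)%N -> (1 <= l)%N -> (l < n)%N ->
      exists B : {set 'I_n},
        covering_set l B /\
        (INR #|B| <= C * (INR n * logm (INR n) / INR l))%R.
Proof.
have [C small] := small_covering_set.
have C_ge0 := pos_INR C.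
(* The 2 converts the binary logarithm; adding 1 makes the constant positive. *)
exists (2 * INR C + 1)%R; split; first by Lra.lra.
move=> n l n_gt1 l_gt0 ln; have [B [covB lB]] := small n l n_gt1 l_gt0 ln.
exists B; split=> //.
have lR : (0 < INR l)%R by apply/lt_0_INR/ssrnat.ltP.
have nR := pos_INR n.
have LR := trunc_log2_le_logm (ltnW n_gt1).
have logm_ge1 : (1 <= logm (INR n))%R by apply: Rmax_r.
have {}lB : (INR l * INR #|B| <= INR C * (INR n * INR (trunc_log 2 n)))%R.
  by rewrite -!mult_INR; apply/le_INR/ssrnat.leP.
apply: (Rmult_le_reg_l (INR l)) => //.
have mulCA a b c : (a * (b * c) = b * (a * c))%R.
  by rewrite -!Rmult_assoc (Rmult_comm a).
rewrite [X in Rle _ X]mulCA.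
have -> : (INR l * (INR n * logm (INR n) / INR l) = INR n * logm (INR n))%R.
  by rewrite Rmult_comm /Rdiv Rmult_assoc Rinv_l ?Rmult_1_r //; Lra.lra.
apply: (Rle_trans _ _ _ lB).
have h1 : (INR n * INR (trunc_log 2 n) <= INR n * (2 * logm (INR n)))%R.
  exact: Rmult_le_compat_l.
have h2 := Rmult_le_compat_l _ _ _ C_ge0 h1.
have h3 : (0 <= INR n * logm (INR n))%R by apply: Rmult_le_pos => //; Lra.lra.
by Lra.lra.
Qed.
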